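(* Let $W\subset\{L,R\}^*/\sim$ be a finite set of equivalence classes of words. Then, as $N\to\infty$, the random variables $(Z_{N,[w]})_{[w]\in W}$ converge in distribution to random variables $(Z_{[w]})_{[w]\in W}$, where: (i) for each $[w]\in W$, $Z_{[w]}$ is an $\mathbb{N}$-valued Poisson distributed random variable with mean $\lambda_{[w]}=\frac{|[w]|}{2|w|}$; (ii) the random variables $Z_{[w]}$ and $Z_{[w']}$ are independent for all $[w],[w']\in W$ with $[w]\neq[w']$.
   Context: For $N\ge 1$, $\Omega_N$ is the set of partitions of $\{1,\dots,6N\}$ into pairs, with the uniform probability measure $\mathbb{P}$. For $\omega\in\Omega_N$, $\Gamma(\omega)$ is the cubic multigraph with vertices $1,\dots,2N$, where vertex $i$ carries the half-edges $3i-2,3i-1,3i$ in this cyclic order, and two half-edges are joined to an edge if they form a pair of $\omega$. The cyclic order at the vertices determines whether a path traversing a vertex turns left or right there. A circuit is a closed path without repeated vertices (a loop is a circuit of length $1$, a double edge gives a circuit of length $2$), considered without starting point and direction. $\{L,R\}^*$ is the set of (nonempty) words in the letters $L,R$; $|w|$ is the number of letters of $w$. Words $w,w'$ are equivalent ($w\sim w'$) if $w'$ is a cyclic permutation of $w$ or of $w^*$, where $w^*$ is $w$ read backwards with every $L$ replaced by $R$ and vice versa. $[w]$ is the equivalence class of $w$ and $|[w]|$ its cardinality. A circuit carries $w$ if, traversing it from some starting vertex in some direction and recording $L$ at each left turn and $R$ at each right turn, one obtains a word equivalent to $w$. Define $Z_{N,[w]}:\Omega_N\to\mathbb{N}$ by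 $$Z_{N,[w]}(\omega)=\left|\{\gamma : \gamma \text{ a circuit on } \Gamma(\omega),\ \gamma\text{ carries } w\}\right|.$$ Convergence in distribution of $\mathbb{N}$-valued random variables $X_{N,1},\dots,X_{N,m}$ to $X_1,\dots,X_m$ means: for all $n_1,\dots,n_m\in\mathbb{N}$ (including $0$), $\lim_{N\to\infty}\mathbb{P}[X_{N,1}=n_1,\dots,X_{N,m}=n_m]=\mathbb{P}[X_1=n_1,\dots,X_m=n_m]$. *)

(* Defs.v *)
From HB Require Import structures.
From mathcomp Require Import all_boot all_order all_algebra finmap generic_quotient.
From mathcomp Require Import all_classical all_reals all_analysis.

Set Implicit Arguments.
Unset Strict Implicit.
Unset Printing Implicit Defensive.

Import Order.TTheory GRing.Theory Num.Theory.
Import numFieldNormedType.Exports.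

Local Open Scope quotient_scope.

Definition is_rot (T : eqType) (s t : seq T) : bool :=
  [exists n : 'I_(size s).+1, t == rot n s].

(* [dihedral f s t]: [t] is a cyclic permutation of [s], or of [s] read
   backwards with [f] applied to each entry. It serves both for words, with
   [f] exchanging L and R, and for closed paths, with [f] reversing each
   passage through a vertex. *)
Definition dihedral (T : eqType) (f : T -> T) (s t : seq T) : bool :=
  is_rot s t || is_rot (rev (map f s)) t.

Lemma is_rotP (T : eqType) (s t : seq T) :
  reflect (exists n, t = rot n s) (is_rot s t).
Proof.
apply: (iffP existsP) => [[n /eqP ->]|[n ->]]; first by exists n.
rewrite rot_minn; have h : minn n (size s) < (size s).+1 by rewrite ltnS geq_minr.
by exists (Ordinal h).
Qed.

Lemma is_rot_refl (T : eqType) : reflexive (@is_rot T).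
Proof. by move=> s; apply/is_rotP; exists 0; rewrite rot0. Qed.

Lemma is_rot_sym (T : eqType) : symmetric (@is_rot T).
Proof.
suff h (s t : seq T) : is_rot s t -> is_rot t s.
  by move=> s t; apply/idP/idP; apply: h.
by case/is_rotP=> n ->; apply/is_rotP; exists (size (rot n s) - n); exact/esym/rotK.
Qed.

Lemma is_rot_trans (T : eqType) : transitive (@is_rot T).
Proof.
move=> t s u /is_rotP[n ->] /is_rotP[m ->]; apply/is_rotP.
by rewrite rot_rot_add; eexists.
Qed.

Lemma is_rot_rev_map (T : eqType) (f : T -> T) (s t : seq T) :
  is_rot s t -> is_rot (rev (map f s)) (rev (map f t)).
Proof.
case/is_rotP=> n ->; rewrite map_rot rev_rot /rotr.
by apply/is_rotP; eexists.
Qed.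

Section DihedralEquivalence.
Variables (T : eqType) (f : T -> T).
Hypothesis f_inv : involutive f.

Let rev_mapK : involutive (fun s : seq T => rev (map f s)).
Proof. by move=> s; rewrite map_rev revK mapK. Qed.

Lemma dihedral_refl : reflexive (dihedral f).
Proof. by move=> s; rewrite /dihedral is_rot_refl. Qed.

Lemma dihedral_sym : symmetric (dihedral f).
Proof.
move=> s t; rewrite /dihedral (is_rot_sym s t); congr (_ || _).
apply/idP/idP => /(is_rot_rev_map f); rewrite rev_mapK is_rot_sym //.
Qed.

Lemma dihedral_trans : transitive (dihedral f).
Proof.
rewrite /dihedral => t s u /orP[st|st] /orP[tu|tu]; apply/orP.
- by left; exact: is_rot_trans tu.
- by right; apply: is_rot_trans tu; exact: is_rot_rev_map.
- by right; exact: is_rot_trans tu.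
- left; apply: is_rot_trans tu.
  by move/(is_rot_rev_map f): st; rewrite rev_mapK.
Qed.

End DihedralEquivalence.

Inductive letter := turnL | turnR.

Definition letter_to_bool (x : letter) : bool := if x is turnL then true else false.
Definition letter_of_bool (b : bool) : letter := if b then turnL else turnR.
Lemma letter_to_boolK : cancel letter_to_bool letter_of_bool.
Proof. by case. Qed.
HB.instance Definition _ := Finite.copy letter (can_type letter_to_boolK).

Definition flip (x : letter) : letter := if x is turnL then turnR else turnL.
Lemma flipK : involutive flip. Proof. by case. Qed.

Definition word := {w : seq letter | w != [::]}.

Definition word_equiv (v w : word) : bool := dihedral flip (val v) (val w).

Lemma word_equiv_refl : reflexive word_equiv.
Proof. by move=> w; exact: dihedral_refl. Qed.
Lemma word_equiv_sym : symmetric word_equiv.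
Proof. by move=> v w; exact: (dihedral_sym flipK). Qed.
Lemma word_equiv_trans : transitive word_equiv.
Proof. by move=> v u w; exact: (dihedral_trans flipK). Qed.

Canonical word_equiv_equiv :=
  EquivRel word_equiv word_equiv_refl word_equiv_sym word_equiv_trans.

Definition word_class := {eq_quot word_equiv}.

Lemma dihedral_repr (w : word) :
  dihedral flip (val (repr (\pi_word_class w))) =1 dihedral flip (val w).
Proof.
have rw : word_equiv (repr (\pi_word_class w)) w.
  by apply/(@eqmodP _ word_equiv_equiv); rewrite reprK.
move=> t; apply/idP/idP; last exact: (dihedral_trans flipK rw).
by apply: (dihedral_trans flipK); rewrite (dihedral_sym flipK).
Qed.

Lemma dihedral_size (T : eqType) (f : T -> T) (s t : seq T) :
  dihedral f s t -> size t = size s.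
Proof. by case/orP=> /is_rotP[n ->]; rewrite size_rot // size_rev size_map. Qed.

Definition class_length (c : word_class) : nat := size (val (repr c)).

(* By [dihedral_size], ranging over tuples loses no member of the class. *)
Definition class_card (c : word_class) : nat :=
  #|[pred t : (class_length c).-tuple letter | dihedral flip (val (repr c)) t]|.

Lemma class_lengthE (w : word) : class_length (\pi_word_class w) = size (val w).
Proof.
have := dihedral_repr w (val (repr (\pi_word_class w))).
by rewrite dihedral_refl => /esym; exact: dihedral_size.
Qed.

Section Circuits.
Variable N : nat.

(* Half-edges and vertices are numbered from 0: the vertex [i < 2N] carries the
   half-edges [3i], [3i+1], [3i+2], in this cyclic order. *)
Definition half_edge := 'I_(6 * N).

Definition vertex (h : half_edge) : nat := h %/ 3.

Definition Omega : {set {set {set half_edge}}} :=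
  finset (fun w => finset.partition w [set: half_edge] && [forall e in w, #|e| == 2]).

(* A passage [(a, b)] through a vertex enters it along the half-edge [a] and
   leaves it along the half-edge [b]. *)
Definition passage := (half_edge * half_edge)%type.

Definition reverse_passage (p : passage) : passage := (p.2, p.1).

(* The cyclic order at a vertex is read counterclockwise, so that a path
   leaving along the successor of the half-edge it came from turns right. *)
Definition turn (p : passage) : letter :=
  if p.2 %% 3 == p.1.+1 %% 3 then turnR else turnL.

(* A circuit with a choice of starting vertex and direction. Since every passage
   has [p.1 != p.2], an edge is never followed by itself backwards. *)
Definition based_circuit (w : {set {set half_edge}}) (s : seq passage) : bool :=
  [&& s != [::],
      all (fun p => (vertex p.1 == vertex p.2) && (p.1 != p.2)) s,
      cycle (fun p q => [set p.2; q.1]%SET \in w) s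
    & uniq [seq vertex p.1 | p <- s]].

(* Forgetting starting point and direction. There are [2N] vertices, so the bound
   on the length excludes no circuit. *)
Definition circuits (w : {set {set half_edge}}) :
    {set {set (2 * N).-bseq passage}} :=
  equivalence_partition
    (fun s t : (2 * N).-bseq passage => dihedral reverse_passage s t)
    (finset (fun s : (2 * N).-bseq passage => based_circuit w s)).

Definition carries (g : {set (2 * N).-bseq passage}) (c : word_class) : bool :=
  [exists s in g, dihedral flip (val (repr c)) (map turn s)].

Definition Z_count (c : word_class) (w : {set {set half_edge}}) : nat :=
  #|[pred g in circuits w | carries g c]|.

End Circuits.

Local Open Scope classical_set_scope.
Local Open Scope ring_scope.

Definition counting_prob (R : realType) (T : finType) (A : {set T})
    (E : pred T) : R :=
  #|[pred x in A | E x]|%:R / #|A|%:R.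

Definition lambda (R : realType) (c : word_class) : R :=
  (class_card c)%:R / (2 * class_length c)%N%:R.

Definition poisson_distributed (R : realType) (d : measure_display)
    (T : measurableType d) (P : probability T R) (Y : {RV P >-> nat})
    (rate : R) : Prop :=
  forall k : nat, P (Y @^-1` [set k]) = (poisson_pmf rate k)%:E.

(* Mutual independence of the whole family; taking [#|J| = 2] gives the
   independence of any two of its members. *)
Definition independent (R : realType) (d : measure_display)
    (T : measurableType d) (P : probability T R) (I : finType)
    (Y : I -> {RV P >-> nat}) : Prop :=
  forall (J : {set I}) (A : I -> set nat),
    P (\bigcap_(i in [set` J]) (Y i @^-1` A i)) =
    (\prod_(i in J) P (Y i @^-1` A i))%E.

(* Convergence in distribution of random variables defined on [Omega N] under
   the uniform probability. *)
Definition cvg_in_distribution (R : realType) (I : finType)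
    (X : forall N : nat, I -> {set {set half_edge N}} -> nat)
    (d : measure_display) (T : measurableType d) (P : probability T R)
    (Y : I -> {RV P >-> nat}) : Prop :=
  forall n : I -> nat,
    (fun N : nat =>
       counting_prob R (Omega N) (fun w => [forall i, X N i w == n i]))
      @ \oo --> fine (P (\bigcap_i (Y i @^-1` [set n i]))).

(* Main.v *)
Require Import Defs.
From HB Require Import structures.
From mathcomp Require Import all_boot all_order all_algebra finmap generic_quotient.
From mathcomp Require Import all_classical all_reals all_analysis.
From mathcomp Require Import zify ring lra.

Set Implicit Arguments.
Unset Strict Implicit.
Unset Printing Implicit Defensive.

Import Order.TTheory GRing.Theory Num.Theory.
Import numFieldNormedType.Exports.

(** The method of factorial moments. In a uniformly random pairing of 6N
    half-edges, l prescribed disjoint pairs occur with probability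
    1/((6N-1)(6N-3)...(6N-2l+1)), and there are |[w]| 3^l (2N)_l paths with l = |w|
    distinct vertices carrying a word of [w], each circuit being described by 2l
    of them; so the mean of Z_[w] tends to |[w]|/(2l), and the expected number of
    vertex-disjoint families of circuits with prescribed classes tends to the
    product of these means, multiplicities included. If any two distinct short
    circuits are vertex-disjoint, this number is a product of falling factorials
    of the Z_[w]. Otherwise two distinct circuits meet, and together with the
    given family they form a subgraph with more edges than vertices; the expected
    number of such subgraphs of bounded size is O(1/N), so these pairings
    contribute nothing to the limit. Truncated inclusion-exclusion turns the
    limits of the joint factorial moments into limits of the joint probabilities. *)

(** * Pairings of a finite set *)

Section Pairings.
Import mathcomp.boot.finset.
Local Open Scope set_scope.
Variable T : finType.
Implicit Types (A e : {set T}) (w : {set {set T}}).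

Definition pairings A : {set {set {set T}}} :=
  finset (fun w => partition w A && [forall e in w, #|e| == 2]).

(* [(n - 1)!!] for even [n], and [0] for odd [n]. *)
Fixpoint pairing_count n : nat :=
  if n is m.+2 then m.+1 * pairing_count m else (n == 0).

Lemma pairingsP A w :
  reflect (partition w A /\ {in w, forall e, #|e| = 2}) (w \in pairings A).
Proof.
rewrite inE; apply: (iffP andP) => [[pw /forall_inP h]|[pw h]]; split=> //.
  by move=> e /h /eqP.
by apply/forall_inP => e /h ->.
Qed.

(** Deleting the block of [a] and [b] and putting it back are inverse bijections. The predicate [P]
    carries further prescribed pairs along the induction in [card_pairings_seq]. *)
Lemma card_pairings_mem (P : pred {set {set T}}) A a b : a \in A -> b \in A -> a != b ->
  #|finset (fun w => [&& w \in pairings A, [set a; b] \in w & P (w :\ [set a; b])])| =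
  #|finset (fun w => (w \in pairings (A :\: [set a; b])) && P w)|.
Proof.
set B := A :\: _; move=> aA bA ab.
have abA : [set a; b] \subset A by rewrite subUset !sub1set aA.
have ab0 : [set a; b] != set0
  by apply/set0Pn; exists a; rewrite !inE eqxx.
have abN w : w \in pairings B -> [set a; b] \notin w.
  move=> /pairingsP[pw _]; apply/negP => abw.
  have : a \in cover w by apply/bigcupP; exists [set a; b] => //; rewrite !inE eqxx.
  by rewrite (cover_partition pw) !inE eqxx.
pose D := finset (fun w => (w \in pairings B) && P w).
have inj : {in D &, injective (fun w => [set a; b] |: w)}.
  move=> v w; rewrite [v \in D]inE [w \in D]inE => /andP[/abN va _] /andP[/abN wa _] vw.
  by rewrite -(setU1K va) vw setU1K.
rewrite -(card_in_imset inj); apply: eq_card => w; rewrite inE.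
apply/and3P/imsetP => [[/pairingsP[pw w2] abw Pw]|[v]].
  exists (w :\ [set a; b]); last by rewrite setD1K.
  rewrite inE Pw andbT; apply/pairingsP; split; first exact: partitionD1.
  by move=> e /setD1P[_ /w2].
rewrite inE => /andP[vB Pv] ->; rewrite setU1K ?abN //.
have /pairingsP[pv v2] := vB; split=> //; last exact: setU11.
apply/pairingsP; split; last by move=> e /setU1P[->|/v2//]; rewrite cards2 ab.
have := partitionU1 pv ab0; rewrite /B setDE setUIr setUCr setIT (setUidPr abA); apply.
by rewrite disjoints_subset setCI setCK subsetUr.
Qed.

(** Fix [x] in [A]. Each pairing joins [x] to exactly one partner [y], and the pairings with this
    partner are those of the remaining elements, two fewer; the resulting recursion is that of
    [pairing_count]. *)
Lemma card_pairings A : #|pairings A| = pairing_count #|A|.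
Proof.
have [n] := ubnP #|A|; elim: n => // n IH in A *; rewrite ltnS => An.
have [->|/set0Pn[x xA]] := eqVneq A set0.
  rewrite cards0 /= -(cards1 (set0 : {set {set T}})); apply: eq_card => w.
  apply/pairingsP/set1P => [[]|->]; first by rewrite partition_set0 => /eqP.
  by split; [rewrite partition_set0 | move=> e; rewrite inE].
have wx w : w \in pairings A -> \sum_(y in A :\ x) ([set x; y] \in w) = 1.
  move=> /pairingsP[pw w2]; have xw : x \in cover w by rewrite (cover_partition pw).
  have ew := pblock_mem xw.
  have [y xy eE] : exists2 y, x != y & pblock w x = [set x; y].
    have := xw; rewrite -mem_pblock; have /eqP/cards2P[u [v [uv ->]]] := w2 _ ew.
    by case/set2P=> ->; [exists v | exists u; rewrite // 1?eq_sym // setUC].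
  have tw := partition_trivIset pw.
  have yA : y \in A :\ x.
    rewrite !inE eq_sym xy -(cover_partition pw); apply/bigcupP.
    by exists (pblock w x) => //; rewrite eE set22.
  rewrite (bigD1 y) //= -eE ew big1 // => z /andP[/setD1P[zx _] zy].
  apply/eqP; rewrite eqb0; apply/negP => xzw.
  have := def_pblock tw xzw (set21 x z); rewrite eE => /setP/(_ z).
  by rewrite !inE eqxx orbT (negPf zx) (negPf zy).
have -> : #|pairings A| =
    \sum_(y in A :\ x) #|finset (fun w => (w \in pairings A) && ([set x; y] \in w))|.
  rewrite -sum1_card -(eq_bigr _ wx) exchange_big /=; apply: eq_bigr => y _.
  by rewrite -sum1dep_card big_mkcondr; apply: eq_bigr => w _; case: ifP.
have cA : #|A| = #|A :\ x|.+1 by rewrite (cardsD1 x) xA.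
transitivity (\sum_(y in A :\ x) pairing_count #|A :\ x|.-1).
  apply: eq_bigr => y /setD1P[yx yA]; rewrite (_ : #|_| = #|pairings (A :\: [set x; y])|).
  have cy : #|A :\ x|.-1 = #|A :\: [set x; y]|.
    by rewrite -setDDl [X in X.-1](cardsD1 y) !inE yx yA.
  by rewrite cy; apply: IH; rewrite -cy; lia.
  have xy : x != y by rewrite eq_sym.
  have := card_pairings_mem predT xA yA xy.
  under eq_finset do rewrite andbT; move=> ->; apply: eq_card => w.
  by rewrite inE andbT.
rewrite sum_nat_const cA; case: #|A :\ x| => [|k] //=.
Qed.

Definition pair_set (p : T * T) : {set T} := [set p.1; p.2].

Definition ends (l : seq (T * T)) : seq T := flatten [seq [:: p.1; p.2] | p <- l].

(** The prescribed pairs are removed one at a time. Since all ends are distinct, removing one pair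
    leaves the other conditions intact. *)
Lemma card_pairings_seq (l : seq (T * T)) A :
    uniq (ends l) -> {subset ends l <= A} ->
  #|finset (fun w => (w \in pairings A) && all (fun p => pair_set p \in w) l)| =
  pairing_count (#|A| - (size l).*2).
Proof.
elim: l => [|[a b] l IH] in A *.
  move=> _ _; rewrite subn0 -card_pairings; apply: eq_card => w.
  by rewrite inE andbT.
rewrite /ends /= -/(ends l) inE negb_or -!andbA => /and4P[ab al bl ul] sA.
have aA : a \in A by rewrite sA ?inE ?eqxx.
have bA : b \in A by rewrite sA ?inE ?eqxx ?orbT.
have abN p : p \in l -> pair_set p != [set a; b].
  move=> pl; apply: contraNneq al => pE; apply/flattenP => /=.
  exists [:: p.1; p.2]; first exact: map_f.
  by have := set21 a b; rewrite -pE !inE.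
pose P w := all (fun p => pair_set p \in w) l.
transitivity #|finset (fun w => [&& w \in pairings A, [set a; b] \in w & P (w :\ [set a; b])])|.
  apply: eq_card => w; rewrite !inE /= /P; congr [&& _, _ & _].
  by apply: eq_in_all => p /abN pN; rewrite in_setD1 pN.
rewrite card_pairings_mem // IH //.
  have := cardsID [set a; b] A; rewrite (setIidPr _) ?subUset ?sub1set ?aA // cards2 ab.
  by move=> <-; congr pairing_count; lia.
move=> x xl; rewrite !inE negb_or sA ?inE ?xl ?orbT // andbT.
by apply/andP; split; [apply: contraNneq al|apply: contraNneq bl] => <-.
Qed.

End Pairings.

(** * Paths and their edges *)

(** Turns the closing condition of a circuit into a condition on a list of edges, which can then be
    counted as prescribed pairs. *)
Lemma cycle_zip (T : Type) (e : rel T) (s : seq T) :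
  cycle e s = all (fun p => e p.1 p.2) (zip s (rot 1 s)).
Proof.
have pathE x t : path e x t = all (fun p => e p.1 p.2) (zip (belast x t) t).
  by elim: t x => //= y t IH x; rewrite IH.
by case: s => //= x s; rewrite rot1_cons pathE belast_rcons.
Qed.

Lemma ends_perm (T : finType) (l : seq (T * T)) :
  perm_eq (ends l) (unzip1 l ++ unzip2 l).
Proof.
elim: l => //= -[a b] l IH; rewrite /ends /= -/(ends l) perm_cons.
rewrite perm_sym -(cat1s b (unzip2 l)) perm_catCA /= perm_cons perm_sym.
exact: IH.
Qed.

Lemma ffactD n k l : n ^_ (k + l) = n ^_ k * (n - k) ^_ l.
Proof.
elim: l => [|l IH]; first by rewrite addn0 ffactn0 muln1.
by rewrite addnS !ffactnSr IH subnDA mulnA.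
Qed.

Definition has_class N (c : word_class) (s : seq (passage N)) : bool :=
  dihedral flip (val (repr c)) (map (@turn N) s).

Section Walks.
Import mathcomp.boot.finset.
Local Open Scope set_scope.
Variable N : nat.
Implicit Types (s t : seq (passage N)) (ss : seq (seq (passage N))).
Implicit Types (w : {set {set half_edge N}}) (c : word_class) (V : seq nat).

Definition passage_ok (p : passage N) : bool :=
  (vertex p.1 == vertex p.2) && (p.1 != p.2).

Definition verts s : seq nat := [seq vertex p.1 | p <- s].

(** The part of [based_circuit] that does not involve the pairing; [on] is the other part. *)
Definition walk s : bool := [&& s != [::], all passage_ok s & uniq (verts s)].

(** A path of length one is its own rotation, so its only edge is the loop joining [p.2] to
    [p.1]. *)
Definition edge_pairs s : seq (half_edge N * half_edge N) :=
  [seq (pq.1.2, pq.2.1) | pq <- zip s (rot 1 s)].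

Definition on w s : bool := all (fun e => pair_set e \in w) (edge_pairs s).

Lemma on_cycle w s : on w s = cycle (fun p q => [set p.2; q.1] \in w) s.
Proof. by rewrite cycle_zip /on all_map; apply: eq_all. Qed.

Lemma based_circuitE w s : based_circuit w s = walk s && on w s.
Proof. by rewrite on_cycle /based_circuit /walk -!andbA; congr (_ && (_ && _)); rewrite andbC. Qed.

Lemma size_edge_pairs s : size (edge_pairs s) = size s.
Proof. by rewrite size_map size1_zip // size_rot. Qed.

(** The edges regroup the half-edges of the passages: every exit is matched with the next entry
    instead of the entry at the same vertex. *)
Lemma ends_edge_pairs s : perm_eq (ends (edge_pairs s)) (ends s).
Proof.
apply: perm_trans (ends_perm _) _; rewrite perm_sym; apply: perm_trans (ends_perm _) _.
have -> : unzip1 (edge_pairs s) = unzip2 s.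
  rewrite /unzip1 -map_comp (map_comp snd fst) -/(unzip1 _) unzip1_zip // size_rot //.
have -> : unzip2 (edge_pairs s) = rot 1 (unzip1 s).
  rewrite /unzip2 -map_comp (map_comp fst snd) -/(unzip2 _) unzip2_zip ?size_rot //.
  by rewrite map_rot.
by rewrite perm_catC perm_cat2l perm_sym perm_rot.
Qed.

Lemma ends_cat (l1 l2 : seq (half_edge N * half_edge N)) : ends (l1 ++ l2) = ends l1 ++ ends l2.
Proof. by rewrite /ends map_cat flatten_cat. Qed.

Lemma ends_flatten_edge_pairs ss :
  perm_eq (ends (flatten (map edge_pairs ss))) (ends (flatten ss)).
Proof.
elim: ss => //= s ss IH; rewrite !ends_cat.
by apply: perm_cat => //; exact: ends_edge_pairs.
Qed.

Lemma size_flatten_edge_pairs ss : size (flatten (map edge_pairs ss)) = size (flatten ss).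
Proof. by elim: ss => //= s ss IH; rewrite !size_cat IH size_edge_pairs. Qed.

Lemma mem_ends_verts s h : all passage_ok s -> h \in ends s -> vertex h \in verts s.
Proof.
elim: s => //= p s IH /andP[/andP[/eqP pv _] oks].
by rewrite !inE pv => /or3P[/eqP->|/eqP->|/IH->]; rewrite ?pv ?eqxx ?orbT.
Qed.

Lemma uniq_ends s : all passage_ok s -> uniq (verts s) -> uniq (ends s).
Proof.
elim: s => //= p s IH /andP[/andP[/eqP pv p12] oks] /andP[ps us].
rewrite inE negb_or p12 IH // andbT; apply/andP; split.
  by apply: contra ps; exact: mem_ends_verts.
by apply: contra ps; rewrite pv; exact: mem_ends_verts.
Qed.

Lemma OmegaE : Omega N = pairings [set: half_edge N].
Proof. by []. Qed.

Lemma card_Omega : #|Omega N| = pairing_count (6 * N).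
Proof. by rewrite OmegaE card_pairings cardsT card_ord. Qed.

(** Distinct vertices carry disjoint sets of half-edges, so the edges of vertex-disjoint paths are
    disjoint pairs and only their number matters. *)
Lemma card_Omega_on ss : all passage_ok (flatten ss) -> uniq (verts (flatten ss)) ->
  \sum_(w in Omega N) all (on w) ss = pairing_count (6 * N - (size (flatten ss)).*2).
Proof.
move=> ok us; pose l := flatten (map edge_pairs ss).
have ul : uniq (ends l) by rewrite (perm_uniq (ends_flatten_edge_pairs ss)) uniq_ends.
have := card_pairings_seq ul (A := [set: half_edge N]) (fun _ _ => in_setT _).
rewrite cardsT card_ord size_flatten_edge_pairs => <-.
rewrite -sum1dep_card big_mkcondr -OmegaE; apply: eq_bigr => w _.
have -> : all (fun p => pair_set p \in w) l = all (on w) ss.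
  by rewrite /l; elim: ss {ok us l ul} => //= s ss IH; rewrite all_cat IH.
by case: all.
Qed.

Definition walks c : seq (seq (passage N)) :=
  map val (enum [pred s : (2 * N).-bseq (passage N) | walk (val s) && has_class c (val s)]).

Definition avoids V s : bool := ~~ has (mem V) (verts s).

(* Families of pairwise vertex-disjoint paths, the i-th one carrying the i-th
   class; the pairing is not involved yet. *)
Fixpoint families (cs : seq word_class) : seq (seq (seq (passage N))) :=
  if cs is c :: cs' then
    [seq s :: ss | ss <- families cs', s <- [seq s <- walks c | avoids (verts (flatten ss)) s]]
  else [:: [::]].

Lemma vertex_lt (h : half_edge N) : vertex h < 2 * N.
Proof. by rewrite /vertex ltn_divLR // -mulnA (mulnC N) mulnA. Qed.

Lemma walk_size s : walk s -> size s <= 2 * N.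
Proof.
case/and3P=> _ _ us; have := uniq_leq_size us (s2 := iota 0 (2 * N)).
rewrite size_map size_iota; apply=> v /mapP[p _ ->].
by rewrite mem_iota /= vertex_lt.
Qed.

Lemma mem_walks c s : (s \in walks c) = walk s && has_class c s.
Proof.
apply/mapP/idP => [[t]|sP]; first by rewrite mem_enum => tP ->.
have sN : size s <= 2 * N by case/andP: sP => /walk_size.
by exists (Bseq sN) => //; rewrite mem_enum.
Qed.

Lemma walks_uniq c : uniq (walks c).
Proof. by rewrite map_inj_uniq ?enum_uniq //; exact: val_inj. Qed.

Lemma has_class_size c s : has_class c s -> size s = class_length c.
Proof. by move/dihedral_size; rewrite size_map. Qed.

Definition total_length (cs : seq word_class) := sumn (map class_length cs).

Lemma familiesP cs ss : ss \in families cs ->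
  [/\ all2 (@has_class N) cs ss, all walk ss, all passage_ok (flatten ss),
      uniq (verts (flatten ss)) & size (flatten ss) = total_length cs].
Proof.
elim: cs ss => [|c cs IH] ss /=; first by rewrite inE => /eqP ->.
case/allpairsPdep => ss' [s [/IH[h1 h2 h3 h4 h5]]].
rewrite mem_filter mem_walks => /and3P[av ws cS] -> /=.
have /and3P[_ oks us] := ws.
split; rewrite ?ws ?cS //.
- by rewrite all_cat oks.
- by rewrite /verts map_cat cat_uniq -!/(verts _) us h4 andbT has_sym.
- by rewrite size_cat h5 (has_class_size cS).
Qed.

End Walks.

(** * The number of paths and of disjoint families carrying given classes *)

Section CountingWalks.
Import mathcomp.boot.finset.
Local Open Scope set_scope.
Variable N : nat.
Implicit Types (s t : seq (passage N)) (ss : seq (seq (passage N))).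
Implicit Types (w : {set {set half_edge N}}) (c : word_class) (V : seq nat).

Lemma half_proof (v : 'I_(2 * N)) (r : 'I_3) : 3 * v + r < 6 * N.
Proof. by case: v r => v ? [r ?] /=; lia. Qed.

Definition half (v : 'I_(2 * N)) (r : 'I_3) : half_edge N := Ordinal (half_proof v r).

Lemma vertex_half v r : vertex (half v r) = v.
Proof. by rewrite /vertex /= mulnC divnMDl // divn_small // addn0. Qed.

Lemma half_mod v r : half v r %% 3 = r.
Proof. by rewrite /= mulnC modnMDl modn_small. Qed.

Definition vert (h : half_edge N) : 'I_(2 * N) := Ordinal (vertex_lt h).

Definition slot (h : half_edge N) : 'I_3 := Ordinal (ltn_pmod h (isT : 0 < 3)).

Lemma half_vert_slot h : half (vert h) (slot h) = h.
Proof. by apply: val_inj; rewrite /= /vertex mulnC -divn_eq. Qed.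

(** The slot of the exit: a right turn leaves along the successor of the entry, and among three
    slots the only other exit is two further on. *)
Definition step (a : letter) (r : 'I_3) : 'I_3 :=
  Ordinal (ltn_pmod (r + (if a is turnR then 1 else 2)) (isT : 0 < 3)).

Definition mk_passage (a : letter) v r : passage N := (half v r, half v (step a r)).

Lemma turn_mk a v r : turn (mk_passage a v r) = a.
Proof.
rewrite /turn half_mod /=; case: r v => [r ?] [v ?] /=.
by case: a; case: eqP => //=; lia.
Qed.

Lemma mk_passage_ok a v r : passage_ok (mk_passage a v r).
Proof.
rewrite /passage_ok !vertex_half eqxx -val_eqE /= eqn_add2l.
by case: r => -[|[|[|//]]] ?; case: a.
Qed.

Lemma mk_passageK (p : passage N) : passage_ok p ->
  mk_passage (turn p) (vert p.1) (slot p.1) = p.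
Proof.
case: p => x y /andP[/= /eqP vxy xy]; rewrite /mk_passage /= half_vert_slot; congr pair.
suff -> : step (turn (x, y)) (slot x) = slot y.
  by rewrite -{2}(half_vert_slot y); congr half; apply: val_inj.
apply: val_inj; rewrite /turn /=; move: xy vxy; rewrite /vertex -val_eqE /=.
by case: eqP => //= xy; case: eqP => /=; lia.
Qed.

Lemma class_length_gt0 c : 0 < class_length c.
Proof. by rewrite lt0n size_eq0; exact: (valP (repr c)). Qed.

Lemma card_ord_notin n V : uniq V -> all (fun v => v < n) V ->
  #|[pred v : 'I_n | val v \notin V]| = n - size V.
Proof.
move=> uV Vn; pose A := [pred v : 'I_n | val v \in V].
have <- : #|A| = size V; last by rewrite -[n in n - _]card_ord -(cardC A) addKn.
rewrite cardE -(size_map val); apply/perm_size/uniq_perm => //.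
  by rewrite map_inj_uniq ?enum_uniq //; exact: val_inj.
move=> v; apply/mapP/idP => [[u]|vV]; first by rewrite mem_enum => uV' ->.
by exists (Ordinal (allP Vn v vV)); rewrite // mem_enum.
Qed.

(** A path carrying [c] amounts to three independent choices: its word of turns, its distinct
    vertices outside [V], and the slot through which it enters each vertex. *)
Lemma count_walks c V : uniq V -> all (fun v => v < 2 * N) V ->
  count (avoids V) (walks N c) =
  class_card c * 3 ^ class_length c * (2 * N - size V) ^_ class_length c.
Proof.
move=> uV V2; set l := class_length c.
pose build (x : l.-tuple letter * (l.-tuple 'I_(2 * N) * l.-tuple 'I_3)) :=
  [seq mk_passage (tnth x.1 i) (tnth x.2.1 i) (tnth x.2.2 i) | i <- enum 'I_l].
pose A := finset (fun t : l.-tuple letter => dihedral flip (val (repr c)) t).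
pose free := [pred v : 'I_(2 * N) | val v \notin V].
pose B := finset (fun t : l.-tuple 'I_(2 * N) => all free t && uniq t).
pose D := setX A (setX B [set: l.-tuple 'I_3]).
(* The three components can be read off the path again, so [build] is injective. *)
have turn_b x : map (@turn N) (build x) = x.1.
  by rewrite -map_comp -[RHS](map_tnth_enum x.1); apply: eq_map => i /=; rewrite turn_mk.
have verts_b x : verts (build x) = map val x.2.1.
  rewrite /verts -map_comp -[in RHS](map_tnth_enum x.2.1) -[RHS]map_comp.
  by apply: eq_map => i /=; exact: vertex_half.
have slot_b x : [seq slot p.1 | p <- build x] = x.2.2.
  rewrite -map_comp -[RHS](map_tnth_enum x.2.2); apply: eq_map => i /=.
  by apply: val_inj; exact: half_mod.
have build_inj : injective build.
  move=> [t [v r]] [t' [v' r']] e; have := turn_b (t, (v, r)); have := verts_b (t, (v, r)).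
  have := slot_b (t, (v, r)); rewrite e turn_b verts_b slot_b /=.
  move=> /esym/val_inj-> /esym/(inj_map val_inj)/val_inj-> /esym/val_inj-> //.
have -> : count (avoids V) (walks N c) = #|D|.
  rewrite -size_filter cardE -(size_map build); apply/perm_size/uniq_perm.
  - exact/filter_uniq/walks_uniq.
  - by rewrite map_inj_uniq ?enum_uniq.
  move=> s; rewrite mem_filter mem_walks; apply/and3P/mapP => [[av ws cs]|[[t [v r]]]].
    have sl := has_class_size cs; have szl : size s == l by rewrite sl.
    pose u := Tuple szl; have su : s = u by [].
    have /and3P[_ oks us] := ws.
    exists (map_tuple (@turn N) u,
      (map_tuple (fun p => vert p.1) u, map_tuple (fun p => slot p.1) u)).
      rewrite mem_enum !in_setX !inE /=.
      rewrite [dihedral _ _ _]cs /= andbT; apply/andP; split.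
        rewrite all_map; apply/allP => p ps /=.
        by apply: contra av => pV; apply/hasP; exists (vertex p.1) => //; apply: map_f.
      by rewrite -(map_inj_uniq val_inj) -map_comp.
    rewrite {1}su -[LHS](map_tnth_enum u); apply: eq_map => i.
    by rewrite !tnth_map mk_passageK //; apply: (allP oks); exact: mem_tnth.
  rewrite mem_enum !in_setX !inE andbT => /and3P[xA xf xu] ->; split.
  - rewrite /avoids verts_b; apply/hasPn => y /mapP[u ux ->].
    exact: (allP xf).
  - apply/and3P; split; first by rewrite -size_eq0 size_map size_enum_ord -lt0n class_length_gt0.
      by apply/allP => p /mapP[i _ ->]; exact: mk_passage_ok.
    by rewrite verts_b map_inj_uniq //; exact: val_inj.
  - by rewrite /has_class turn_b.
rewrite !cardsX cardsT card_tuple card_ord card_uniq_tuples.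
rewrite card_ord_notin // mulnA mulnAC; congr (_ * _ * _).
by apply: eq_card => t; rewrite inE.
Qed.

(** Paths are added one by one. The number of choices for the next depends only on how many vertices
    are taken, and [ffactD] joins the falling factorials. *)
Lemma size_families cs :
  size (families N cs) =
  \prod_(c <- cs) class_card c * 3 ^ total_length cs * (2 * N) ^_ total_length cs.
Proof.
elim: cs => [|c cs IH] /=; first by rewrite big_nil ffactn0.
rewrite size_allpairs_dep.
have -> : [seq size [seq s <- walks N c | avoids (verts (flatten ss)) s] | ss <- families N cs]
   = [seq class_card c * 3 ^ class_length c * (2 * N - total_length cs) ^_ class_length c
     | ss <- families N cs].
  apply/eq_in_map => ss /familiesP[_ _ _ us sz]; rewrite size_filter count_walks //.
    by rewrite size_map sz.
  by apply/allP => v /mapP[p _ ->]; exact: vertex_lt.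
rewrite sumnE big_map big_const_seq count_predT iter_addn_0 IH big_cons.
rewrite /total_length /= -/(total_length cs) [class_length c + _]addnC ffactD expnD.
by rewrite mulnC; lia.
Qed.

Definition family_count cs w : nat := \sum_(ss <- families N cs) all (on w) ss.

(** Exchanging the sums: every family lies on the same number of pairings. *)
Lemma sum_family_count cs :
  \sum_(w in Omega N) family_count cs w =
  \prod_(c <- cs) class_card c * 3 ^ total_length cs * (2 * N) ^_ total_length cs *
  pairing_count (6 * N - (total_length cs).*2).
Proof.
rewrite /family_count exchange_big /= -size_families.
rewrite (@eq_big_seq _ _ _ _ _ _ (fun=> pairing_count (6 * N - (total_length cs).*2))).
  by rewrite big_const_seq count_predT iter_addn_0 mulnC.
by move=> ss /familiesP[_ _ ok us sz]; rewrite card_Omega_on // sz.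
Qed.

End CountingWalks.

(** * Circuits as orbits of based circuits *)

Lemma uniq_map_inj (T1 T2 : eqType) (f : T1 -> T2) (s : seq T1) :
  uniq (map f s) -> {in s &, injective f}.
Proof.
elim: s => //= x s IH /andP[xs us] y z.
rewrite !inE => /orP[/eqP->|ys] /orP[/eqP->|zs] //.
- by move=> e; rewrite e map_f in xs.
- by move=> e; rewrite -e map_f in xs.
- exact: IH.
Qed.

Section Orbits.
Import mathcomp.boot.finset.
Local Open Scope set_scope.
Variable N : nat.
Implicit Types (p q : passage N) (s t : seq (passage N)) (ss : seq (seq (passage N))).
Implicit Types (w : {set {set half_edge N}}) (c : word_class) (V : seq nat).

Local Notation dih := (dihedral (@reverse_passage N)).

Definition rev_walk s : seq (passage N) := rev (map (@reverse_passage N) s).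

Lemma reverse_passageK : involutive (@reverse_passage N).
Proof. by case. Qed.

Lemma dihP s t : dih s t -> exists n, t = rot n s \/ t = rot n (rev_walk s).
Proof. by case/orP => /is_rotP[n ->]; exists n; [left|right]. Qed.

Lemma dih_sym s t : dih s t = dih t s.
Proof. exact: (dihedral_sym reverse_passageK). Qed.

Lemma passage_ok_reverse p : passage_ok (reverse_passage p) = passage_ok p.
Proof. by rewrite /passage_ok /= eq_sym [p.2 == p.1]eq_sym. Qed.

(** Reversal exchanges entry and exit, and among three half-edges in cyclic order exactly one of two
    distinct ones is the successor of the other. Hence reversing a path replaces its word [w] by the
    reversed and flipped word. *)
Lemma turn_reverse p : passage_ok p -> turn (reverse_passage p) = flip (turn p).
Proof.
case: p => x y /andP[]; rewrite /turn /vertex -val_eqE /= => /eqP vxy xy.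
by case: eqP => yx; case: eqP => //; lia.
Qed.

Lemma verts_rev_walk s : all (@passage_ok N) s -> verts (rev_walk s) = rev (verts s).
Proof.
move=> oks; rewrite /verts /rev_walk map_rev -map_comp; congr rev.
by apply/eq_in_map => p /(allP oks)/andP[/eqP ->].
Qed.

Lemma perm_verts_dih s t : all (@passage_ok N) s -> dih s t -> perm_eq (verts t) (verts s).
Proof.
move=> oks /dihP[n [] ->]; rewrite /verts map_rot perm_rot //.
by rewrite -/(verts (rev_walk s)) verts_rev_walk // perm_rev.
Qed.

Lemma passage_ok_dih s t : dih s t -> all (@passage_ok N) t = all (@passage_ok N) s.
Proof.
move=> /dihP[n [] ->]; rewrite (perm_all _ (permEl (perm_rot _ _))) //.
rewrite (perm_all _ (permEl (perm_rev _))) all_map; apply: eq_all => p /=.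
exact: passage_ok_reverse.
Qed.

Lemma walk_dih s t : walk s -> dih s t -> walk t.
Proof.
case/and3P=> s0 oks us st; apply/and3P; split.
- by rewrite -size_eq0 (dihedral_size st) size_eq0.
- by rewrite (passage_ok_dih st).
- by rewrite (perm_uniq (perm_verts_dih oks st)).
Qed.

Lemma on_dih w s t : dih s t -> on w t = on w s.
Proof.
move=> /dihP[n [] ->]; rewrite !on_cycle rot_cycle // rev_cycle cycle_map.
by apply: eq_cycle => p q /=; rewrite setUC.
Qed.

Lemma turn_dih s t : all (@passage_ok N) s -> dih s t ->
  dihedral flip (map (@turn N) s) (map (@turn N) t).
Proof.
move=> oks /dihP[n [] ->]; rewrite map_rot; apply/orP; [left|right]; apply/is_rotP; exists n => //.
congr rot; rewrite /rev_walk map_rev -!map_comp; congr rev.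
by apply/eq_in_map => p /(allP oks) /turn_reverse.
Qed.

Lemma has_class_dih c s t : all (@passage_ok N) s -> dih s t -> has_class c s -> has_class c t.
Proof. by move=> oks /(turn_dih oks) st cs; exact: (dihedral_trans flipK cs st). Qed.

Lemma has_class_inj c c' s : has_class c s -> has_class c' s -> c = c'.
Proof.
move=> cs c's; rewrite -[c]reprK -[c']reprK.
apply/(@eqmodP _ word_equiv_equiv); apply: (dihedral_trans flipK cs).
by rewrite (dihedral_sym flipK).
Qed.

Definition orbit s : seq (seq (passage N)) :=
  [seq rot n s | n <- iota 0 (size s)] ++ [seq rot n (rev_walk s) | n <- iota 0 (size s)].

Lemma mem_orbit s t : s != [::] -> (t \in orbit s) = dih s t.
Proof.
move=> s0; have rotE (u : seq (passage N)) : size u = size s ->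
    (t \in [seq rot n u | n <- iota 0 (size s)]) = is_rot u t.
  move=> us; rewrite -us; apply/mapP/is_rotP => [[n _ ->]|[n ->]]; first by exists n.
  have [nu|un] := ltnP n (size u); first by exists n; rewrite ?mem_iota.
  by exists 0; rewrite ?rot0 ?rot_oversize // mem_iota us lt0n size_eq0.
by rewrite mem_cat !rotE // /rev_walk size_rev size_map.
Qed.

Lemma size_orbit s : size (orbit s) = 2 * size s.
Proof. by rewrite size_cat !size_map size_iota mul2n addnn. Qed.

(* The first passages of the members of the orbit are the passages of [s] and
   their reversals, which are all distinct. *)
Lemma orbit_uniq s : walk s -> uniq (orbit s).
Proof.
case/and3P; case: s => // p0 s' _; set s := p0 :: s' => oks us.
have heads (u : seq (passage N)) : map (head p0) [seq rot n u | n <- iota 0 (size u)] = u.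
  rewrite -map_comp -[RHS](mkseq_nth p0); apply/eq_in_map => n.
  rewrite mem_iota /= => nu; rewrite /rot (drop_nth p0) //.
have sr : size (rev_walk s) = size s by rewrite size_rev size_map.
apply: (@map_uniq _ _ (head p0)); rewrite map_cat heads -sr heads.
have us' : uniq s by exact: map_uniq us.
rewrite cat_uniq us' rev_uniq map_inj_uniq ?us' ?andbT; last exact: inv_inj reverse_passageK.
apply/hasPn => p; rewrite mem_rev => /mapP[q qs ->]; apply/negP => rqs.
have /andP[/eqP vq q12] := allP oks q qs.
(* Each vertex is passed once, so a passage whose reversal is also on the path equals this reversal;
   then its two half-edges coincide. *)
have /(congr1 fst)/= e := uniq_map_inj us rqs qs (esym vq).
by rewrite e eqxx in q12.
Qed.

Lemma card_dih s : walk s ->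
  #|[pred t : (2 * N).-bseq (passage N) | dih s t]| = 2 * size s.
Proof.
move=> ws; have s0 : s != [::] by case/and3P: ws.
rewrite -size_orbit cardE -(size_map val); apply/perm_size/uniq_perm.
- by rewrite map_inj_uniq ?enum_uniq //; exact: val_inj.
- exact: orbit_uniq.
move=> t; rewrite mem_orbit //; apply/mapP/idP => [[u]|st]; first by rewrite mem_enum => su ->.
have tN := walk_size (walk_dih ws st).
by exists (Bseq tN) => //; rewrite mem_enum.
Qed.

(** The based circuits carrying [c] split into circuits, and each circuit is an orbit with one
    member for every starting vertex and direction. *)
Lemma Z_countE c w : count (on w) (walks N c) = 2 * class_length c * Z_count c w.
Proof.
pose R (s t : (2 * N).-bseq (passage N)) := dih s t.
pose D := finset (fun s : (2 * N).-bseq (passage N) => based_circuit w s).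
pose B := finset (fun s : (2 * N).-bseq (passage N) => (s \in D) && has_class c s).
pose Q := finset (fun g => (g \in circuits w) && carries g c).
have Dok (s : (2 * N).-bseq (passage N)) : s \in D -> all (@passage_ok N) s.
  by rewrite inE based_circuitE => /andP[/and3P[]].
have eqR : {in D & &, equivalence_rel R}.
  move=> x y z _ _ _; split; first exact: dihedral_refl.
  move=> xy; apply/idP/idP; last exact: (dihedral_trans reverse_passageK xy).
  by apply: (dihedral_trans reverse_passageK); rewrite dih_sym.
have pD : partition (circuits w) D := equivalence_partitionP eqR.
have QP g : g \in Q -> exists2 x, x \in B & g = finset (fun y => (y \in D) && R x y).
  rewrite inE => /andP[/imsetP[x xD ->] /existsP[s /andP[]]].
  rewrite inE => /andP[sD xs] sc; exists x => //; rewrite inE xD /=.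
  by apply: has_class_dih sc; [exact: Dok | rewrite dih_sym].
(* Carrying [c] is invariant under change of start and direction, so a circuit lies entirely inside
   [B] or entirely outside. *)
have pQ : partition Q B.
  apply/and3P; split.
  - rewrite eqEsubset; apply/andP; split; apply/fintype.subsetP => x.
      case/bigcupP => g /QP[y]; rewrite inE => /andP[yD yc] ->; rewrite inE => /andP[xD xy].
      by rewrite inE xD; apply: has_class_dih yc => //; exact: Dok.
    rewrite inE => /andP[xD xc]; apply/bigcupP.
    exists (finset (fun y => (y \in D) && R x y)); last by rewrite inE xD /R dihedral_refl.
    rewrite inE; apply/andP; split; first by apply/imsetP; exists x.
    apply/existsP; exists x; rewrite inE xD /R dihedral_refl //.
  - apply: trivIsetS (partition_trivIset pD); apply/fintype.subsetP => g.
    by rewrite inE => /andP[].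
  - by rewrite inE negb_and; case/and3P: pD => _ _ ->.
have cQ : {in Q, forall g : {set (2 * N).-bseq (passage N)}, #|g| = 2 * class_length c}.
  move=> g /QP[x]; rewrite inE => /andP[xD xc] ->.
  move: (xD); rewrite inE based_circuitE => /andP[wx ox].
  rewrite -(has_class_size xc) -(card_dih wx); apply: eq_card => y.
  rewrite inE andbC /R; apply: andb_idr => xy.
  by rewrite inE based_circuitE (walk_dih wx xy) (on_dih _ xy).
have -> : count (on w) (walks N c) = #|B|.
  rewrite -size_filter cardE -(size_map val); apply/perm_size/uniq_perm.
  - exact/filter_uniq/walks_uniq.
  - by rewrite map_inj_uniq ?enum_uniq //; exact: val_inj.
  move=> s; rewrite mem_filter mem_walks; apply/and3P/mapP => [[os ws cs]|[t]].
    exists (Bseq (walk_size ws)) => //.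
    by rewrite mem_enum !inE based_circuitE; apply/andP; split=> //; apply/andP.
  by rewrite mem_enum !inE based_circuitE => /andP[/andP[wt ot] ct] ->.
rewrite (card_uniform_partition cQ pQ) mulnC; congr (_ * _).
by apply: eq_card => g; rewrite inE.
Qed.

End Orbits.

(** * Factorial moments where short circuits do not meet *)

Section Good.
Import mathcomp.boot.finset.
Local Open Scope set_scope.
Variable N : nat.
Implicit Types (p q : passage N) (s t : seq (passage N)) (ss : seq (seq (passage N))).
Implicit Types (w : {set {set half_edge N}}) (c : word_class) (V : seq nat).

Local Notation dih := (dihedral (@reverse_passage N)).

Definition short_walk M w s : bool := [&& walk s, on w s & size s <= M].

(** Bounded sequences make the condition decidable. They lose no path, as [goodP] shows by means of
    [walk_size]. *)
Definition good M w : bool :=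
  [forall s : (2 * N).-bseq (passage N), [forall t : (2 * N).-bseq (passage N),
    [&& short_walk M w s, short_walk M w t & ~~ avoids (verts s) t] ==> dih s t]].

Lemma goodP M w : reflect
  (forall s t, short_walk M w s -> short_walk M w t -> ~~ avoids (verts s) t -> dih s t)
  (good M w).
Proof.
apply: (iffP forallP) => [h s t ss st av|h s]; last first.
  by apply/forallP => t; apply/implyP => /and3P[]; exact: h.
have sN : size s <= 2 * N by case/and3P: ss => /walk_size.
have tN : size t <= 2 * N by case/and3P: st => /walk_size.
by have /forallP/(_ (Bseq tN)) := h (Bseq sN); rewrite ss st av.
Qed.

Lemma avoids_cat V1 V2 s : avoids (V1 ++ V2) s = avoids V1 s && avoids V2 s.
Proof.
by rewrite /avoids -negb_or -has_predU; congr negb; apply: eq_has => v; rewrite /= mem_cat.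
Qed.

Lemma avoids_perm V s t : perm_eq (verts s) (verts t) -> avoids V s = avoids V t.
Proof. by move=> st; rewrite /avoids (perm_has _ st). Qed.

(* When short circuits that meet are equal, the based circuits excluded by the
   family are the [2 * class_length c] versions of each of its members in [c]. *)
Lemma count_extensions M w c cs ss :
    good M w -> class_length c <= M -> all (fun c' => class_length c' <= M) cs ->
    ss \in families N cs -> all (on w) ss ->
  count (fun s => on w s && avoids (verts (flatten ss)) s) (walks N c) +
    2 * class_length c * count_mem c cs = count (on w) (walks N c).
Proof.
move=> gw cM; elim: cs ss => [|c' cs IH] ss /=.
  move=> _; rewrite inE => /eqP-> _; rewrite muln0 addn0.
  by apply: eq_count => s; rewrite /avoids /= has_pred0 ?andbT // has_sym.
case/andP=> c'M csM /allpairsPdep[ss' [s [ss'F]]].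
rewrite mem_filter mem_walks => /and3P[av ws cs'] -> /= /andP[os oss'].
rewrite -(IH _ csM ss'F oss') mulnDr addnA; congr (_ + _).
have sM : size s <= M by rewrite (has_class_size cs').
have shs : short_walk M w s by apply/and3P.
pose P t := on w t && avoids (verts (flatten ss')) t.
pose L := [seq t <- walks N c | P t].
(* The paths that avoid the rest of the family either avoid [s] as well or meet [s]; by goodness the
   latter are versions of [s]. *)
rewrite -[RHS]size_filter -/L -(count_predC (avoids (verts s))); congr (_ + _).
  rewrite count_filter; apply: eq_count => t.
  by rewrite /= /P {1}/verts map_cat avoids_cat -!/(verts _) andbCA.
have dL t : (t \in L) && ~~ avoids (verts s) t -> dih s t.
  rewrite mem_filter mem_walks => /andP[/andP[/andP[ot _] /andP[wt ct]] st].
  by apply: (goodP _ _ gw) => //; apply/and3P; split; rewrite // (has_class_size ct).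
have oks : all (@passage_ok N) s by case/and3P: ws.
(* A path carries only one class, so for [c'] different from [c] no version of [s] is among the
   paths considered; for [c' = c] all of [orbit s] is. *)
have [cc'|cc'] := eqVneq c' c; last first.
  apply/esym/eqP; rewrite muln0 eqn0Ngt -has_count; apply/hasPn => t tL.
  apply: contra cc' => st; have /dL sdt : (t \in L) && ~~ avoids (verts s) t by rewrite tL.
  move: tL; rewrite mem_filter mem_walks => /and3P[_ _ ct].
  exact/eqP/(has_class_inj (has_class_dih oks sdt cs') ct).
rewrite muln1 -cc' -(has_class_size cs') -size_orbit -size_filter.
apply/esym/perm_size/uniq_perm; rewrite ?orbit_uniq ?filter_uniq ?walks_uniq // => t.
have s0 : s != [::] by case/and3P: ws.
rewrite mem_orbit // mem_filter andbC; apply/idP/idP; first exact: dL.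
move=> st; have vst := perm_verts_dih oks st; rewrite mem_filter mem_walks /P -cc'.
rewrite (on_dih w st) os (walk_dih ws st) (has_class_dih oks st cs') (avoids_perm _ vst) av.
rewrite /= (avoids_perm _ vst) /avoids negbK /=; apply/hasP.
by case: (s) s0 => // p s' _; exists (vertex p.1); rewrite /= inE eqxx.
Qed.

(** By [count_extensions], all families for [cs] on [w] have the same number of extensions. *)
Lemma family_count_cons M w c cs :
    good M w -> class_length c <= M -> all (fun c' => class_length c' <= M) cs ->
  family_count (c :: cs) w =
  family_count cs w * (2 * class_length c * (Z_count c w - count_mem c cs)).
Proof.
move=> gw cM csM; rewrite /family_count big_allpairs_dep big_distrl /=.
apply: eq_big_seq => ss ssF; rewrite big_filter.
case: (boolP (all (on w) ss)) => oss; last first.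
  by rewrite big1 // => s _; rewrite andbF.
have := count_extensions gw cM csM ssF oss; rewrite Z_countE mul1n mulnBr => <-.
rewrite addnK -sum1_count big_mkcond [RHS]big_mkcond /=; apply: eq_bigr => s _.
by rewrite andbT; case: on => //=; case: avoids.
Qed.

(** Repeating a class contributes the factors [Z], [Z - 1], and so on, which form a falling
    factorial. Injectivity of [f] keeps the multiplicities of different indices apart. *)
Lemma family_countE (I : finType) (f : I -> word_class) M w (r : seq I) :
    injective f -> good M w -> (forall i, class_length (f i) <= M) ->
  family_count (map f r) w =
  \prod_i ((2 * class_length (f i)) ^ count_mem i r * Z_count (f i) w ^_ count_mem i r).
Proof.
move=> f_inj gw fM; elim: r => [|i r IH] /=.
  by rewrite /family_count /= big_seq1 big1.
rewrite (family_count_cons gw) ?all_map //; last by apply/allP => j _ /=.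
rewrite IH count_map (bigD1 i) // [RHS](bigD1 i) //= eqxx add1n expnS ffactnSr.
rewrite [in RHS](eq_bigr (fun j => (2 * class_length (f j)) ^ count_mem j r *
  Z_count (f j) w ^_ count_mem j r)) => [|j ji]; last by rewrite eq_sym (negPf ji).
rewrite (@eq_count _ (preim f (pred1 (f i))) (pred1 i)); last first.
  by move=> j; rewrite /= (inj_eq f_inj).
move: (_ - _) (_ ^ _) (_ ^_ _) (\prod_(_ | _) _) => a b d e; ring.
Qed.

End Good.

(** * Pairings in which short circuits meet *)

(** A common start and unique successors force the paths to agree until the shorter one ends. *)
Lemma path_deterministic (T : eqType) (e : rel T) x s t :
    (forall y z z', z \in s -> z' \in t -> e y z -> e y z' -> z = z') ->
    path e x s -> path e x t ->
  s = take (size s) t \/ t = take (size t) s.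
Proof.
elim: s x t => [|z s IH] x [|z' t] /=; try by [left | right].
move=> det /andP[xz ps] /andP[xz' pt].
have zz' : z = z' by apply: (det x z z' _ _ xz xz'); rewrite inE eqxx.
rewrite -zz' in pt *; have [] := IH z t _ ps pt.
- by move=> y u u' us u't; apply: det; rewrite inE ?us ?u't orbT.
- by move=> st; left; rewrite -st.
- by move=> st; right; rewrite -st.
Qed.

(** The final [x] marks the return to the start of a cycle. Were [rcons s x] a proper prefix, its
    last entry would lie in [t]. *)
Lemma rcons_take_inj (T : eqType) (s t : seq T) x : x \notin t ->
  rcons s x = take (size (rcons s x)) (rcons t x) -> s = t.
Proof.
move=> xt; rewrite size_rcons; have [st e|ts] := ltnP (size s) (size t).
  case/negP: xt; apply: (mem_take (n0 := (size s).+1)).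
  by move: e; rewrite -(cats1 t) takel_cat // => <-; rewrite mem_rcons inE eqxx.
rewrite take_oversize ?size_rcons // => /eqP.
by rewrite eqseq_rcons eqxx andbT => /eqP.
Qed.

Section BadPairings.
Import mathcomp.boot.finset.
Local Open Scope set_scope.
Variable N : nat.
Implicit Types (p q : passage N) (s t : seq (passage N)) (ss : seq (seq (passage N))).
Implicit Types (w : {set {set half_edge N}}) (c : word_class) (V : seq nat).
Implicit Types (l : seq (half_edge N * half_edge N)) (H : seq (half_edge N)).

Local Notation dih := (dihedral (@reverse_passage N)).

Lemma pairing_meet (w : {set {set half_edge N}}) (e e' : {set half_edge N}) h : w \in Omega N ->
  e \in w -> e' \in w -> h \in e -> h \in e' -> e = e'.
Proof.
rewrite OmegaE => /pairingsP[/partition_trivIset tw _] ew e'w he he'.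
by rewrite -(def_pblock tw ew he) (def_pblock tw e'w he').
Qed.

Lemma pairing_neq w a b : w \in Omega N -> [set a; b] \in w -> a != b.
Proof.
rewrite OmegaE => /pairingsP[_ w2] /w2; rewrite cards2.
by case: eqP.
Qed.

Lemma partner_uniq w a b b' : w \in Omega N ->
  [set a; b] \in w -> [set a; b'] \in w -> b = b'.
Proof.
move=> wO ab ab'; have e := pairing_meet wO ab ab' (set21 a b) (set21 a b').
have := set22 a b; rewrite e => /set2P[ba|//].
by have := pairing_neq wO ab; rewrite ba eqxx.
Qed.

(** For paths, failure of this is a branching: two passages that together use all three half-edges
    of a vertex. *)
Definition agree s t := forall p q, p \in s -> q \in t ->
  vertex p.1 = vertex q.1 -> q = p \/ q = reverse_passage p.

(* Where two paths agree, each passage determines the next one: the edge gives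
   the half-edge through which the next vertex is entered. *)
Lemma agree_rot w s t p : w \in Omega N -> walk s -> on w s -> walk t -> on w t ->
  agree s t -> p \in s -> p \in t -> is_rot s t.
Proof.
move=> wO /and3P[_ oks us] os /and3P[_ okt ut] ot ag ps pt.
have [i s' si] := rot_to ps; have [j t' tj] := rot_to pt.
suff st' : s' = t'.
  apply: (@is_rot_trans _ (rot i s)); first by apply/is_rotP; exists i.
  by rewrite is_rot_sym; apply/is_rotP; exists j; rewrite si tj st'.
pose e (y z : passage N) := [set y.2; z.1] \in w.
have cs : cycle e (p :: s') by rewrite -si rot_cycle -on_cycle.
have ct : cycle e (p :: t') by rewrite -tj rot_cycle -on_cycle.
have mems q : q \in rcons s' p -> q \in s by rewrite mem_rcons -si mem_rot.
have memt q : q \in rcons t' p -> q \in t by rewrite mem_rcons -tj mem_rot.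
(* Both [z] and [z'] enter through the partner of [y.2]. By agreement they are equal or mutually
   reversed, and reversal would make entry and exit of [z] the same half-edge. *)
have det y z z' : z \in rcons s' p -> z' \in rcons t' p -> e y z -> e y z' -> z = z'.
  move=> /mems zs /memt z't yz yz'; have z1 := partner_uniq wO yz yz'.
  have [//|zr] := ag _ _ zs z't (congr1 (@vertex N) z1).
  by have /andP[_] := allP oks z zs; rewrite z1 zr eqxx.
have ps' : p \notin s'.
  by have /andP[] : uniq (p :: s') by rewrite -si rot_uniq; exact: map_uniq us.
have pt' : p \notin t'.
  by have /andP[] : uniq (p :: t') by rewrite -tj rot_uniq; exact: map_uniq ut.
have [/rcons_take_inj->//|/rcons_take_inj-> //] := path_deterministic det cs ct.
Qed.

(** At a common vertex the paths make the same passage or opposite ones; in the second case [t] is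
    reversed before [agree_rot] applies. *)
Lemma agree_dih w s t : w \in Omega N -> walk s -> on w s -> walk t -> on w t ->
  agree s t -> ~~ avoids (verts s) t -> dih s t.
Proof.
move=> wO ws os wt ot ag; rewrite negbK => /hasP[v /mapP[q qt ->] /mapP[p ps vpq]].
have [qp|qp] := ag p q ps qt (esym vpq).
  by apply/orP; left; apply: (agree_rot wO ws os wt ot ag ps); rewrite -qp.
have rt : dih t (rev_walk t) by apply/orP; right; exact: is_rot_refl.
have ptr : p \in rev_walk t.
  by rewrite mem_rev; apply/mapP; exists q; rewrite // qp reverse_passageK.
have st : is_rot s (rev_walk t).
  apply: (agree_rot wO ws os (walk_dih wt rt) _ _ ps ptr); first by rewrite (on_dih w rt).
  move=> p' q' p's; rewrite mem_rev => /mapP[q0 q0t ->] v0.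
  have okt : all (@passage_ok N) t by case/and3P: wt.
  have /andP[/eqP vq0 _] := allP okt _ q0t.
  have [->|->] := ag p' q0 p's q0t (etrans v0 (esym vq0)); [by right|left].
  exact: reverse_passageK.
have := dihedral_trans (@reverse_passageK N) (y := rev_walk t) (x := s) (z := t).
by apply; [apply/orP; left | rewrite dih_sym].
Qed.

(** The paths of a bad configuration may share edges, in either orientation. Blocks of a pairing are
    equal or disjoint, so keeping one copy of each edge makes the ends distinct, as counting by
    [card_pairings_seq] requires. *)
Lemma ends_undup w l : w \in Omega N -> all (fun e => pair_set e \in w) l ->
  exists l', [/\ uniq (ends l'), ends l' =i ends l, all (fun e => pair_set e \in w) l'
                & size l' <= size l].
Proof.
move=> wO; elim: l => [|[a b] l IH] /=; first by exists [::].
case/andP=> abw /IH[l' [ul' el' wl' sl']].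
have mem_l' (h : half_edge N) : h \in ends l' -> h \in [set a; b] ->
    (a \in ends l') && (b \in ends l').
  case/flattenP => x /mapP[e el ->] he hab.
  have ew := allP wl' e el.
  have E : pair_set e = [set a; b].
    by apply: (pairing_meet (h := h) wO ew abw) => //; move: he; rewrite !inE.
  apply/andP; split; apply/flattenP; exists [:: e.1; e.2]; rewrite ?map_f //.
    by have := set21 a b; rewrite -E !inE.
  by have := set22 a b; rewrite -E !inE.
case: (boolP (a \in ends l')) => al.
  have /andP[_ bl] := mem_l' a al (set21 a b).
  exists l'; split=> //; last exact: leqW.
  by move=> h; rewrite /ends /= -/(ends l) !inE -el'; case: eqP => [->|_]; case: eqP => [->|_];
     rewrite ?al ?bl.
case: (boolP (b \in ends l')) => bl.
  by have /andP[al' _] := mem_l' b bl (set22 a b); rewrite al' in al.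
exists ((a, b) :: l'); split=> //=.
- by rewrite /ends /= -/(ends l') inE negb_or al bl ul' (pairing_neq wO abw).
- by move=> h; rewrite /ends /= -/(ends l) -/(ends l') !inE el'.
- by rewrite abw.
Qed.

(* Edges on at most [n.+1] vertices are coded by a choice of vertices [f] and a
   list of bounded complexity independent of [N]. *)
Definition realize n (f : {ffun 'I_n.+1 -> 'I_(2 * N)})
    (l : seq (('I_n.+1 * 'I_3) * ('I_n.+1 * 'I_3))) : seq (half_edge N * half_edge N) :=
  [seq (half (f x.1.1) x.1.2, half (f x.2.1) x.2.2) | x <- l].

Lemma size_ends l : size (ends l) = (size l).*2.
Proof. by elim: l => //= e l; rewrite /ends /= => ->. Qed.

Lemma realize_surj n l (h0 : half_edge N) : h0 \in ends l ->
    #|[set vert h | h in ends l]| <= n.+1 ->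
  exists f k, size k = size l /\ @realize n f k = l.
Proof.
pose A := [set vert h | h in ends l]; rewrite -/A => h0l An; pose r := enum A.
(* The default [vert h0] fills [f] up when there are fewer than [n.+1] vertices. *)
pose f := [ffun i : 'I_n.+1 => nth (vert h0) r i].
pose code (h : half_edge N) : 'I_n.+1 * 'I_3 := (inord (index (vert h) r), slot h).
exists f, [seq (code e.1, code e.2) | e <- l]; rewrite size_map; split=> //.
have codeK h : h \in ends l -> half (f (code h).1) (code h).2 = h.
  move=> hl; have hA : vert h \in r by rewrite mem_enum; apply/imsetP; exists h.
  rewrite ffunE inordK ?nth_index ?half_vert_slot //.
  by apply: leq_trans An; rewrite cardE index_mem.
rewrite /realize -map_comp -[RHS]map_id; apply/eq_in_map => e el /=.
by rewrite !codeK -?surjective_pairing //; apply/flattenP; exists [:: e.1; e.2];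
   rewrite ?map_f // !inE eqxx ?orbT.
Qed.

(* Each vertex on a path carries at least two of the half-edges in use, and the
   vertex where [p] and [q] differ carries three. *)
Lemma branching_vertices l s (p q : passage N) :
    all (@passage_ok N) s -> ends l =i ends s -> uniq (ends l) -> p \in s -> q \in s ->
    vertex p.1 = vertex q.1 -> q != p -> q != reverse_passage p ->
  #|[set vert h | h in ends l]| < size l.
Proof.
move=> oks els ul ps qs vpq qp qrp; set A := [set vert h | h in ends l].
pose U := finset (mem (ends l)).
have cU : #|U| = (size l).*2 by rewrite cardsE (card_uniqP ul) size_ends.
have mem_s r : r \in s -> (r.1 \in ends l) && (r.2 \in ends l).
  move=> rs; rewrite !els; apply/andP.
  by split; apply/flattenP; exists [:: r.1; r.2]; rewrite ?map_f // !inE eqxx ?orbT.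
have same r : r \in s -> vert r.1 = vert r.2 /\ r.1 != r.2.
  by move=> /(allP oks)/andP[/eqP rv r12]; split=> //; apply: val_inj.
(* Each edge has two ends, so it is enough that the half-edges number more than two per vertex; they
   are counted vertex by vertex. *)
suff : (#|A|).*2 < #|U| by rewrite cU ltn_double.
have -> : #|U| = \sum_(v in A) #|[set h in U | vert h == v]|.
  rewrite -sum1_card (partition_big (@vert N) (mem A)) /=.
    by apply: eq_bigr => v _; rewrite -sum1dep_card.
  by move=> h; rewrite inE => hl; apply/imsetP; exists h.
have vA : vert p.1 \in A by apply/imsetP; exists p.1; case/andP: (mem_s p ps).
have -> : (#|A|).*2.+1 = \sum_(v in A) (2 + (v == vert p.1)).
  rewrite big_split /= sum_nat_const muln2 (bigD1 (vert p.1)) //= eqxx big1 ?addn1 //.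
  by move=> v /andP[_ /negPf->].
apply: leq_sum => v /imsetP[h hl ->].
have fiber r : r \in s -> vert h = vert r.1 ->
    [set r.1; r.2] \subset [set h' in U | vert h' == vert h].
  move=> rs vr; have [rv _] := same r rs; have /andP[r1 r2] := mem_s r rs.
  by rewrite subUset !sub1set !inE vr r1 r2 rv !eqxx.
have [r rs vr] : exists2 r, r \in s & vert h = vert r.1.
  move: hl; rewrite els => /flattenP[x /mapP[r rs ->]] hr; exists r => //; move: hr.
  by case: (same r rs) => rv _; rewrite !inE => /orP[] /eqP ->.
case: eqP => hp; last first.
  rewrite addn0; apply: leq_trans (subset_leq_card (fiber r rs vr)).
  by rewrite cards2; case: (same r rs) => _ ->.
have sp := fiber p ps hp; have vq : vert h = vert q.1.
  by rewrite hp; apply: val_inj.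
have sq := fiber q qs vq.
have : [set p.1; p.2] :|: [set q.1; q.2] \subset [set h' in U | vert h' == vert h].
  by rewrite subUset sp sq.
move/subset_leq_card; apply: leq_trans.
have [_ p12] := same p ps; have [_ q12] := same q qs.
have <- : #|[set p.1; p.2]|.+1 = 2 + true by rewrite cards2 p12.
apply: proper_card.
apply/properP; split; first exact: subsetUl.
(* A third half-edge is [q.1] or [q.2]: if both belonged to [p], then [q] would be [p] or its
   reversal. *)
case: (boolP (q.1 \in [set p.1; p.2])) => [q1|q1]; last by exists q.1; rewrite // !inE eqxx !orbT.
exists q.2; first by rewrite !inE eqxx !orbT.
apply/negP => q2; move: q1 q2 qp qrp q12; rewrite !inE -!pair_eqE /pair_eq /=.
by move=> /orP[] /eqP-> /orP[] /eqP->; rewrite !eqxx ?andbT.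
Qed.

End BadPairings.

(** * The mean number of families on bad pairings *)

Section BadFamilies.
Import mathcomp.boot.finset.
Local Open Scope set_scope.
Variable N : nat.
Implicit Types (p q : passage N) (s t : seq (passage N)) (ss : seq (seq (passage N))).
Implicit Types (w : {set {set half_edge N}}) (c : word_class) (cs : seq word_class).
Implicit Types (l : seq (half_edge N * half_edge N)) (H : seq (half_edge N)).

Lemma not_good_branching M w : w \in Omega N -> ~~ good M w ->
  exists s t p q, [/\ short_walk M w s, short_walk M w t, p \in s /\ q \in t
    & [&& vertex p.1 == vertex q.1, q != p & q != reverse_passage p]].
Proof.
move=> wO /forallPn[s /forallPn[t]]; rewrite negb_imply => /andP[/and3P[shs sht meet] /negP st].
have [hs|/hasPn hs] := boolP (has (fun p => has (fun q =>
  [&& vertex p.1 == vertex q.1, q != p & q != reverse_passage p]) t) s).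
  by have /hasP[p ps /hasP[q qt pq]] := hs; exists s, t, p, q.
case: st; have /and3P[ws os _] := shs; have /and3P[wt ot _] := sht.
apply: (agree_dih wO ws os wt ot _ meet) => p q ps qt vpq.
have /hasPn/(_ q qt) := hs p ps; rewrite vpq eqxx /= negb_and !negbK.
by case/orP=> /eqP; [left|right].
Qed.

(** [H] stands for the half-edges of a family, required to lie in the coded subgraph; with empty [H]
    only the subgraph is required to occur in [w]. *)
Definition realized w H n (f : {ffun 'I_n.+1 -> 'I_(2 * N)})
    (k : n.+2.-tuple (('I_n.+1 * 'I_3) * ('I_n.+1 * 'I_3))) : bool :=
  [&& uniq (ends (realize f k)), all (fun e => pair_set e \in w) (realize f k)
    & all (mem (ends (realize f k))) H].

(** The edges of the two meeting circuits and of the family, without repetitions, form a subgraph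
    with fewer vertices than edges, by [branching_vertices]. *)
Lemma bad_realized M cs w ss : w \in Omega N -> ~~ good M w ->
    ss \in families N cs -> all (on w) ss ->
  exists (n : 'I_(2 * M + total_length cs)) f k, @realized w (ends (flatten ss)) n f k.
Proof.
move=> wO /(not_good_branching wO)[s [t [p [q [shs sht [ps qt] /and3P[/eqP vpq qp qrp]]]]]].
move=> /familiesP[_ _ okss _ szss] oss.
have /and3P[/and3P[_ oks _] os sM] := shs; have /and3P[/and3P[_ okt _] ot tM] := sht.
pose l0 := flatten (map (@edge_pairs N) (s :: t :: ss)).
have wl0 : all (fun e => pair_set e \in w) l0.
  rewrite /l0 /= !all_cat; apply/and3P; split=> //.
  by elim: (ss) oss => //= s' ss' IH /andP[os' /IH ?]; rewrite all_cat; apply/andP.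
have [l [ul el wl sl]] := ends_undup wO wl0.
have els : ends l =i ends (flatten (s :: t :: ss)).
  by move=> h; rewrite el (perm_mem (ends_flatten_edge_pairs _)).
have ok : all (@passage_ok N) (flatten (s :: t :: ss)) by rewrite /= !all_cat oks okt okss.
have ps' : p \in flatten (s :: t :: ss) by rewrite /= !mem_cat ps.
have qs' : q \in flatten (s :: t :: ss) by rewrite /= !mem_cat qt orbT.
have br := branching_vertices ok els ul ps' qs' vpq qp qrp.
have pl : p.1 \in ends l.
  by rewrite els; apply/flattenP; exists [:: p.1; p.2]; rewrite ?map_f // !inE eqxx.
have A0 : 0 < #|[set vert h | h in ends l]|.
  by rewrite card_gt0; apply/set0Pn; exists (vert p.1); apply/imsetP; exists p.1.
have sl0 : size l <= 2 * M + total_length cs.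
  apply: leq_trans sl _; rewrite size_flatten_edge_pairs /= !size_cat szss.
  by rewrite addnA leq_add2r mul2n -addnn leq_add.
(* At least one vertex and more edges than vertices: there are at least two edges, whence the form
   [n.+2]. *)
case nE : (size l) (leq_ltn_trans A0 br) => [|[|n]] // _.
have nlt : n < 2 * M + total_length cs by apply: leq_trans sl0; rewrite nE.
rewrite nE ltnS in br; have [f [k [sk rk]]] := realize_surj pl br.
have szk : size k == n.+2 by rewrite sk nE.
exists (Ordinal nlt), f, (Tuple szk); rewrite /realized /= rk ul wl /=.
by apply/allP => h hss; rewrite /= els /= !ends_cat !mem_cat hss !orbT.
Qed.

(** Each passage is one of the ordered pairs of half-edges from [H]. The bound is crude, but
    independent of [N]. *)
Lemma walks_within c H :
  count (fun s => all (mem H) (ends s)) (walks N c) <= (size H ^ 2) ^ class_length c.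
Proof.
pose P := [seq (a, b) | a <- H, b <- H].
pose lists := fix lists m : seq (seq (passage N)) :=
  if m is m'.+1 then [seq p :: s | p <- P, s <- lists m'] else [:: [::]].
have szl m : size (lists m) = (size H ^ 2) ^ m.
  by elim: m => //= m IH; rewrite size_allpairs IH size_allpairs [RHS]expnS -mulnn.
have mem_lists s : all (mem H) (ends s) -> s \in lists (size s).
  elim: s => //= p s IH /and3P[p1 p2 /IH sl]; apply/allpairsP; exists (p, s); split=> //.
  by apply/allpairsP; exists (p.1, p.2); split; rewrite -?surjective_pairing.
rewrite -size_filter -szl; apply: uniq_leq_size; first exact/filter_uniq/walks_uniq.
move=> s; rewrite mem_filter mem_walks => /and3P[sH _ cs].
by rewrite -(has_class_size cs); exact: mem_lists.
Qed.

Lemma families_within cs H :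
  \sum_(ss <- families N cs) all (mem H) (ends (flatten ss)) <= (size H ^ 2) ^ total_length cs.
Proof.
elim: cs => [|c cs IH] /=; first by rewrite big_seq1.
rewrite big_allpairs_dep /total_length /= addnC expnD.
apply: leq_trans (leq_mul IH (walks_within c H)); rewrite big_distrl /=.
apply: leq_sum => ss _; rewrite big_filter -sum1_count big_mkcond.
rewrite big_distrr /= [X in _ <= X]big_mkcond.
apply: leq_sum => s _; rewrite ends_cat all_cat.
by case: avoids; case: (all _ (ends s)) => //=; rewrite ?muln1.
Qed.

(** A union bound over the coded subgraphs; the families inside one of them are counted by
    [families_within], with [(n.+2).*2] half-edges available. *)
Lemma family_count_bad M cs w : w \in Omega N -> ~~ good M w ->
  family_count cs w <= \sum_(n < 2 * M + total_length cs)
    \sum_(f : {ffun 'I_n.+1 -> 'I_(2 * N)})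
    \sum_(k : n.+2.-tuple (('I_n.+1 * 'I_3) * ('I_n.+1 * 'I_3)))
      realized w [::] f k * ((n.+2).*2 ^ 2) ^ total_length cs.
Proof.
move=> wO bad; pose F ss n f k := @realized w (ends (flatten ss)) n f k : nat.
apply: (@leq_trans (\sum_(ss <- families N cs) \sum_(n < 2 * M + total_length cs)
   \sum_(f : {ffun 'I_n.+1 -> 'I_(2 * N)})
   \sum_(k : n.+2.-tuple (('I_n.+1 * 'I_3) * ('I_n.+1 * 'I_3))) F ss n f k)).
  rewrite /family_count big_seq [X in _ <= X]big_seq; apply: leq_sum => ss ssF.
  case: (boolP (all (on w) ss)) => // oss.
  have [n [f [k r]]] := bad_realized wO bad ssF oss.
  by rewrite (bigD1 n) //= (bigD1 f) //= (bigD1 k) //= /F r.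
rewrite exchange_big; apply: leq_sum => n _; rewrite exchange_big; apply: leq_sum => f _.
rewrite exchange_big; apply: leq_sum => k _; rewrite /F /realized /= andbT.
case: (boolP (uniq _)) => //= ur; last by rewrite big1.
case: (all (fun e => pair_set e \in w) _) => /=; last by rewrite big1.
rewrite mul1n; apply: leq_trans (families_within _ _) _.
by rewrite size_ends size_map size_tuple.
Qed.

(* Since [n.+2] edges are prescribed on [n.+1] vertices, this is [O(1 / N)] times
   the number of pairings. *)
Definition bad_bound M cs := \sum_(n < 2 * M + total_length cs)
  (2 * N) ^ n.+1 * ((n.+1 * 3) ^ 2) ^ n.+2 * ((n.+2).*2 ^ 2) ^ total_length cs *
  pairing_count (6 * N - (n.+2).*2).

(** After exchanging the sums, the factors of [bad_bound] count the vertex choices, the codes, the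
    families inside the subgraph and the pairings containing it. *)
Lemma sum_family_count_bad M cs :
  \sum_(w in Omega N | ~~ good M w) family_count cs w <= bad_bound M cs.
Proof.
apply: (@leq_trans (\sum_(w in Omega N) \sum_(n < 2 * M + total_length cs)
    \sum_(f : {ffun 'I_n.+1 -> 'I_(2 * N)})
    \sum_(k : n.+2.-tuple (('I_n.+1 * 'I_3) * ('I_n.+1 * 'I_3)))
      realized w [::] f k * ((n.+2).*2 ^ 2) ^ total_length cs)).
  rewrite big_mkcondr; apply: leq_sum => w wO.
  by case: ifP => // /family_count_bad; apply.
rewrite exchange_big; apply: leq_sum => n _; rewrite exchange_big /=.
rewrite -2!mulnA.
have -> : (2 * N) ^ n.+1 = #|{ffun 'I_n.+1 -> 'I_(2 * N)}| by rewrite card_ffun !card_ord.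
rewrite -sum_nat_const; apply: leq_sum => f _; rewrite exchange_big /=.
have -> : ((n.+1 * 3) ^ 2) ^ n.+2 = #|{: n.+2.-tuple (('I_n.+1 * 'I_3) * ('I_n.+1 * 'I_3))}|.
  by rewrite card_tuple !card_prod !card_ord mulnn.
rewrite -sum_nat_const; apply: leq_sum => k _.
rewrite -big_distrl /= mulnC leq_mul2l; apply/orP; right.
rewrite /realized /=; case: (boolP (uniq _)) => /= ur; last by rewrite big1.
have := card_pairings_seq ur (A := [set: half_edge N]) (fun _ _ => in_setT _).
rewrite cardsT card_ord size_map size_tuple => <-.
rewrite -sum1dep_card big_mkcondr -OmegaE leq_eqVlt; apply/orP; left; apply/eqP.
by apply: eq_bigr => w _; rewrite andbT; case: all.
Qed.

End BadFamilies.

(** * The method of factorial moments *)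

Section Moments.
Local Open Scope ring_scope.
Local Open Scope classical_set_scope.
Variable R : realType.

Lemma cvg_sumr (I : Type) (r : seq I) (P : pred I) (u : I -> nat -> R) (l : I -> R) :
    (forall i, P i -> u i @ \oo --> l i) ->
  (fun N => \sum_(i <- r | P i) u i N) @ \oo --> \sum_(i <- r | P i) l i.
Proof. by move=> ul; apply: cvg_big => //; exact: add_continuous. Qed.

Lemma cvg_prodr (I : Type) (r : seq I) (P : pred I) (u : I -> nat -> R) (l : I -> R) :
    (forall i, P i -> u i @ \oo --> l i) ->
  (fun N => \prod_(i <- r | P i) u i N) @ \oo --> \prod_(i <- r | P i) l i.
Proof. by move=> ul; apply: cvg_big => //; exact: mul_continuous. Qed.

(** For positive [m] and [J] the alternating sum is, up to sign, ['C(m.-1, J.-1)], which Pascal's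
    rule bounds by ['C(m, J)]. *)
Lemma alternating_bin (m J : nat) :
  `|(m == 0%N)%:R - \sum_(j < J) (-1) ^+ j * 'C(m, j)%:R| <= 'C(m, J)%:R :> R.
Proof.
case: m => [|m].
  case: J => [|J]; first by rewrite big_ord0 subr0 normr1.
  rewrite big_ord_recl big1 => [|j _]; last by rewrite bin0n mulr0.
  by rewrite bin0 expr0 mulr1 addr0 subrr normr0.
have alt k : \sum_(j < k.+1) (-1) ^+ j * 'C(m.+1, j)%:R = (-1) ^+ k * 'C(m, k)%:R :> R.
  elim: k => [|k IH]; first by rewrite big_ord_recl big_ord0 !bin0 addr0.
  rewrite big_ord_recr /= IH binS natrD exprS; ring.
case: J => [|J]; first by rewrite big_ord0 subr0 normr0.
rewrite sub0r normrN alt normrM normrX normrN1 expr1n mul1r normr_nat.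
by rewrite ler_nat binS leq_addl.
Qed.

(** Dividing the falling factorial by [n! j!] gives ['C(x, n) 'C(x - n, j)]. The claim is thus
    [alternating_bin] for [x - n], multiplied by ['C(x, n)]. *)
Lemma bonferroni (x n J : nat) :
  `|(x == n)%:R - \sum_(j < J) (-1) ^+ j / (n`! * j`!)%:R * (x ^_ (n + j))%:R|
   <= (n`! * J`!)%:R^-1 * (x ^_ (n + J))%:R :> R.
Proof.
have fE j : (n`! * j`!)%:R^-1 * (x ^_ (n + j))%:R = 'C(x, n)%:R * 'C(x - n, j)%:R :> R.
  rewrite ffactD -!bin_ffact -natrM; apply: (canLR (mulKf _)).
    by rewrite pnatr_eq0 muln_eq0 !gtn_eqF ?fact_gt0.
  by rewrite -natrM; congr (_%:R); ring.
rewrite fE; under eq_bigr do rewrite -mulrA fE mulrCA.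
rewrite -big_distrr /=; have [xn|nx] := ltnP x n.
  by rewrite bin_small // !mul0r ltn_eqF // subr0 normr0.
have -> : (x == n)%:R = 'C(x, n)%:R * (x - n == 0)%N%:R :> R.
  rewrite subn_eq0; have [->|xn] := eqVneq x n; first by rewrite binn leqnn mulr1.
  by rewrite leqNgt ltn_neqAle eq_sym xn nx mulr0.
by rewrite -mulrBr normrM normr_nat ler_wpM2l ?ler0n // alternating_bin.
Qed.

(* Transfers the Bonferroni inequalities to products of indicators. *)
Lemma prod_diff_le (I : Type) (r : seq I) (a b e : I -> R) :
    (forall i, `|a i| <= 1) -> (forall i, `|a i - b i| <= e i) ->
  `|\prod_(i <- r) a i - \prod_(i <- r) b i| <= \prod_(i <- r) (1 + e i) - 1.
Proof.
move=> a1 abe; elim: r => [|i r IH]; first by rewrite !big_nil !subrr normr0.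
have e0 j : 0 <= e j by exact: le_trans (abe j).
have A1 : `|\prod_(j <- r) a j| <= 1.
  elim: (r) => [|j r' IHr]; rewrite ?big_nil ?normr1 // big_cons normrM.
  by rewrite mulr_ile1.
rewrite !big_cons; move: IH A1 (abe i) (a1 i) (e0 i).
move: (\prod_(j <- r) a j) (\prod_(j <- r) b j) (\prod_(j <- r) (1 + e j)) => A B P.
move: (a i) (b i) (e i) => x y z AB A1 xy x1 z0.
(* Writing [B] as [A - (A - B)] bounds its absolute value by [P], since [A] is at most 1 and [A - B]
   at most [P - 1] in absolute value. *)
have -> : x * A - y * B = x * (A - B) + (x - y) * (A - (A - B)) by ring.
apply: le_trans (ler_normD _ _) _; rewrite !normrM.
have h1 : `|x| * `|A - B| <= P - 1 by rewrite -[P - 1]mul1r ler_pM.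
have h2 : `|x - y| * `|A - (A - B)| <= z * P.
  by rewrite ler_pM // (le_trans (ler_normB _ _)) //; lra.
by apply: le_trans (lerD h1 h2) _; rewrite le_eqVlt; apply/orP; left; apply/eqP; ring.
Qed.

(* The weights need not have total mass [1]: they will be uniform on the good
   pairings and [0] elsewhere. *)
Variables (I : finType) (T : nat -> finType) (u : forall N, T N -> R).
Variables (X : forall N, I -> T N -> nat) (rate : I -> R).
Hypothesis u_ge0 : forall N (x : T N), 0 <= u x :> R.
Hypothesis moments : forall k : I -> nat,
  (fun N => \sum_(x : T N) u x * \prod_i (X i x ^_ k i)%:R) @ \oo --> \prod_i rate i ^+ k i.

(** Expanding the product of sums gives a finite linear combination of joint factorial moments. *)
Lemma polynomial_moments J (a : I -> nat -> R) (k : I -> nat -> nat) :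
  (fun N => \sum_(x : T N) u x * \prod_i \sum_(j < J) a i j * (X i x ^_ k i j)%:R) @ \oo -->
  \prod_i \sum_(j < J) a i j * rate i ^+ k i j.
Proof.
have distr (F : I -> nat -> R) : \prod_i \sum_(j < J) a i j * F i j =
    \sum_(f : {ffun I -> 'I_J}) (\prod_i a i (f i)) * \prod_i F i (f i).
  by rewrite bigA_distr_bigA; apply: eq_bigr => f _; rewrite big_split.
rewrite (distr (fun i j => rate i ^+ k i j)).
rewrite (_ : (fun N => _) = (fun N => \sum_(f : {ffun I -> 'I_J}) (\prod_i a i (f i)) *
   \sum_(x : T N) u x * \prod_i (X i x ^_ k i (f i))%:R)).
  by apply: cvg_sumr => f _; apply: cvgMl_tmp; exact: moments.
apply/funext => N.
under eq_bigr => x _ do rewrite (distr (fun i j => (X i x ^_ k i j)%:R)) big_distrr /=.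
rewrite exchange_big; apply: eq_bigr => f _; rewrite big_distrr; apply: eq_bigr => x _.
by rewrite mulrCA.
Qed.

(** The Bonferroni sums truncated at [J] approximate the indicator by [b] with error controlled by
    [e]. For fixed [J] both have limits in [N], namely [beta J] and [eps J]; these in turn tend to
    the Poisson product and to 0. *)
Lemma cvg_pmf_of_moments (n : I -> nat) :
  (fun N => \sum_(x : T N) u x * [forall i, X i x == n i]%:R) @ \oo -->
  \prod_i (rate i ^+ n i * (n i)`!%:R^-1 * expR (- rate i)).
Proof.
pose a i j : R := (-1) ^+ j / ((n i)`! * j`!)%:R.
pose b J i x : R := \sum_(j < J) a i j * (x ^_ (n i + j))%:R.
pose e J i x : R := ((n i)`! * J`!)%:R^-1 * (x ^_ (n i + J))%:R.
pose beta J : R := \prod_i \sum_(j < J) a i j * rate i ^+ (n i + j).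
pose eps J : R := \prod_i (1 + ((n i)`! * J`!)%:R^-1 * rate i ^+ (n i + J)) - 1.
have cvb J : (fun N => \sum_(x : T N) u x * \prod_i b J i (X i x)) @ \oo --> beta J.
  exact: (@polynomial_moments J a (fun i j => (n i + j)%N)).
have cve J : (fun N => \sum_(x : T N) u x * (\prod_i (1 + e J i (X i x)) - 1)) @ \oo --> eps J.
  (* The total weight is the moment of order zero, so it tends to 1. *)
  have c0 := @moments (fun=> 0%N).
  rewrite (_ : (fun N => _) = (fun N => \sum_(x : T N) u x * \prod_i (1 + e J i (X i x)) -
      \sum_(x : T N) u x * \prod_(i : I) (X i x ^_ 0)%:R)); last first.
    apply/funext => N; rewrite -sumrB; apply: eq_bigr => x _.
    by rewrite mulrBr mulr1 [X in _ = _ - _ * X]big1 ?mulr1.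
  apply: cvgB; last by move: c0; rewrite big1.
  (* With these coefficients [1 + e] becomes a sum of two falling factorials, of orders 0 and
     [n i + J]. *)
  pose c i j : R := if j == 0%N then 1 else ((n i)`! * J`!)%:R^-1.
  pose k i j := if j == 0%N then 0%N else (n i + J)%N.
  have -> : \prod_i (1 + ((n i)`! * J`!)%:R^-1 * rate i ^+ (n i + J)) =
      \prod_i \sum_(j < 2) c i j * rate i ^+ k i j.
    by apply: eq_bigr => i _; rewrite 2!big_ord_recl big_ord0 /= mul1r addr0 expr0.
  rewrite (_ : (fun N => _) = (fun N => \sum_(x : T N) u x *
      \prod_i \sum_(j < 2) c i j * (X i x ^_ k i j)%:R)).
    exact: polynomial_moments.
  apply/funext => N; apply: eq_bigr => x _; congr (_ * _).
  by apply: eq_bigr => i _; rewrite 2!big_ord_recl big_ord0 /= mul1r addr0.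
have cbeta : beta @ \oo --> \prod_i (rate i ^+ n i * (n i)`!%:R^-1 * expR (- rate i)).
  apply: cvg_prodr => i _.
  (* Pulling out [rate i ^+ n i / (n i)!] leaves the partial sums of the exponential series at
     [- rate i]. *)
  rewrite (_ : (fun J => _) = (fun J => rate i ^+ n i * (n i)`!%:R^-1 *
      series (exp_coeff (- rate i)) J)).
    by apply: cvgMl_tmp; exact: is_cvg_series_exp_coeff.
  apply/funext => J; rewrite /series /= big_mkord big_distrr /=; apply: eq_bigr => j _.
  rewrite /a /exp_coeff /= natrM invfM exprD [(- rate i) ^+ j]exprNn.
  by move: ((-1) ^+ j) (rate i ^+ n i) (rate i ^+ j) => x y z; ring.
have ceps : eps @ \oo --> (0 : R).
  rewrite -[0](subrr 1); apply: cvgB; last exact: cvg_cst.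
  rewrite -[X in _ --> X](_ :
      \prod_(i : I) (1 + (n i)`!%:R^-1 * rate i ^+ n i * 0) = _); last first.
    by rewrite big1 // => i _; rewrite mulr0 addr0.
  apply: cvg_prodr => i _; apply: cvgD; first exact: cvg_cst.
  rewrite (_ : (fun J => _) = (fun J => (n i)`!%:R^-1 * rate i ^+ n i * exp_coeff (rate i) J)).
    by apply: cvgMl_tmp; exact: cvg_exp_coeff.
  by apply/funext => J; rewrite /exp_coeff /= natrM invfM exprD; ring.
have dist N J : `|\sum_(x : T N) u x * \prod_i b J i (X i x) -
     \sum_(x : T N) u x * [forall i, X i x == n i]%:R|
   <= \sum_(x : T N) u x * (\prod_i (1 + e J i (X i x)) - 1).
  rewrite -sumrB; apply: le_trans (ler_norm_sum _ _ _) _; apply: ler_sum => x _.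
  rewrite -mulrBr normrM ger0_norm // ler_wpM2l // distrC.
  have -> : [forall i, X i x == n i]%:R = \prod_i (X i x == n i)%:R :> R.
    case: forallP => [h|/existsNP[i /negP/negPf ni]].
      by rewrite big1 // => i _; rewrite h.
    by rewrite (bigD1 i) //= ni mul0r.
  apply: prod_diff_le => i; last exact: bonferroni.
  by rewrite normr_nat lern1 leq_b1.
apply/cvgrPdist_le => /= d d0; have d4 : 0 < d / 4 by rewrite divr_gt0.
(* [J] is fixed first, then [N] is taken large. Of the four quarters of [d], two pay for the limit
   of [b] and two for the error term. *)
near \oo => J.
have hbeta : `|\prod_i (rate i ^+ n i * (n i)`!%:R^-1 * expR (- rate i)) - beta J| <= d / 4.
  by near: J; move/cvgrPdist_le : cbeta; apply.
have heps : `|0 - eps J| <= d / 4 by near: J; move/cvgrPdist_le : ceps; apply.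
near=> N.
have hb : `|beta J - \sum_(x : T N) u x * \prod_i b J i (X i x)| <= d / 4.
  by near: N; move/cvgrPdist_le : (cvb J); apply.
have he : `|eps J - \sum_(x : T N) u x * (\prod_i (1 + e J i (X i x)) - 1)| <= d / 4.
  by near: N; move/cvgrPdist_le : (cve J); apply.
have hd := dist N J.
move: hbeta heps hb he hd; rewrite !ler_norml; lra.
Unshelve. all: by end_near. Qed.

End Moments.

(** * Independent Poisson variables *)

Section IndependentPoisson.
Local Open Scope classical_set_scope.
Local Open Scope ring_scope.
Local Open Scope ereal_scope.
Variable R : realType.

Lemma RV_of_measurable d (T : measurableType d) (P : probability T R) (f : T -> nat) :
  measurable_fun setT f -> exists Y : {RV P >-> nat}, Y =1 f.
Proof. by move=> mf; exists (mfun_Sub (mem_set mf)). Qed.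

Lemma measurable_RV d (T : measurableType d) (P : probability T R) (Y : {RV P >-> nat}) A :
  measurable (Y @^-1` A).
Proof. by rewrite -[X in measurable X]setTI; apply: (measurable_funP Y). Qed.

Lemma poisson_prob_set1 (r : R) k : (0 < r)%R ->
  poisson_prob r 0 [set k] = (poisson_pmf r k)%:E.
Proof.
move=> r0; rewrite /poisson_prob r0 esum_set1 // lee_fin.
exact: poisson_pmf_ge0.
Qed.

(** Induction by product measures: the new variable is the second coordinate, the old ones depend on
    the first. *)
Lemma independent_poisson_ord n (rate : 'I_n -> R) : (forall i, 0 < rate i)%R ->
  exists (d : measure_display) (T : measurableType d) (P : probability T R)
      (Z : 'I_n -> {RV P >-> nat}),
    (forall i, poisson_distributed (Z i) (rate i)) /\
    (forall A : 'I_n -> set nat,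
      P (\bigcap_i (Z i @^-1` A i)) = \prod_i P (Z i @^-1` A i)).
Proof.
elim: n rate => [|n IH] rate rate0.
  pose P : probability nat R := poisson_prob 1 0.
  have Z : 'I_0 -> {RV P >-> nat} by case.
  exists _, nat, P, Z.
  split=> [[]|A] //; rewrite big_ord0 (_ : \bigcap_i _ = setT) ?probability_setT //.
  by apply/seteqP; split=> // x _ [].
have [d [T [P [Z [Zp Zi]]]]] := IH (fun i => rate (lift ord0 i)) (fun i => rate0 _).
pose Q : probability nat R := poisson_prob (rate ord0) 0.
pose PQ : probability (T * nat)%type R := P \x Q.
have PQE (A : set T) (B : set nat) : measurable A -> PQ (A `*` B) = P A * Q B.
  by move=> mA; rewrite /PQ /= product_measure1E.
have /choice[Z' Z'E] i : exists Y : {RV PQ >-> nat},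
    Y =1 if unlift ord0 i is Some j then (fun x => Z j x.1) else snd.
  apply: RV_of_measurable; case: unliftP => [j _|_]; last exact: measurable_snd.
  exact: (measurableT_comp (measurable_funP (Z j)) measurable_fst).
have Z'0 A : Z' ord0 @^-1` A = setT `*` A.
  by apply/seteqP; split=> -[x y] /=; rewrite Z'E unlift_none => // -[].
have Z'S j A : Z' (lift ord0 j) @^-1` A = (Z j @^-1` A) `*` setT.
  by apply/seteqP; split=> -[x y] /=; rewrite Z'E liftK => // -[].
have P'0 A : PQ (Z' ord0 @^-1` A) = Q A by rewrite Z'0 PQE // probability_setT mul1e.
have P'S j A : PQ (Z' (lift ord0 j) @^-1` A) = P (Z j @^-1` A).
  by rewrite Z'S PQE ?probability_setT ?mule1 //; exact: measurable_RV.
exists _, _, PQ, Z'; split=> [i k|A].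
  case: (unliftP ord0 i) => [j ->|->]; first by rewrite P'S Zp.
  by rewrite P'0 [LHS]poisson_prob_set1.
rewrite big_ord_recl P'0; under eq_bigr do rewrite P'S.
rewrite -(Zi (fun j => A (lift ord0 j))) muleC -PQE; last first.
  by apply: fin_bigcap_measurable => // j _; exact: measurable_RV.
congr (PQ _); apply/seteqP; split=> [[x y] h|[x y] [/= hx hy] i _].
  split=> [j _|] /=; first by have := h (lift ord0 j) I; rewrite Z'S => -[].
  by have := h ord0 I; rewrite Z'0 => -[].
by case: (unliftP ord0 i) => [j ->|->]; rewrite ?Z'S ?Z'0; split=> //; exact: hx.
Qed.

Lemma independent_poisson (J : finType) (rate : J -> R) : (forall i, 0 < rate i)%R ->
  exists (d : measure_display) (T : measurableType d) (P : probability T R)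
      (Z : J -> {RV P >-> nat}),
    (forall i, poisson_distributed (Z i) (rate i)) /\ independent Z.
Proof.
move=> rate0.
have [d [T [P [Z [Zp Zi]]]]] := independent_poisson_ord
  (rate := fun i : 'I_#|J| => rate (enum_val i)) (fun i => rate0 _).
exists d, T, P, (fun i => Z (enum_rank i)); split=> [i|K A].
  by rewrite -{2}(enum_rankK i); exact: Zp.
(* Imposing no condition outside [K] turns a subfamily into the full family. *)
pose B (i : 'I_#|J|) : set nat := if enum_val i \in K then A (enum_val i) else setT.
have -> : \bigcap_(i in [set` K]) (Z (enum_rank i) @^-1` A i) = \bigcap_i (Z i @^-1` B i).
  apply/seteqP; split=> x h i.
    by move=> _; rewrite /B /=; case: ifP => // iK; have := h _ iK; rewrite enum_valK.
  by move=> /= iK; have := h (enum_rank i) I; rewrite /B /= enum_rankK iK.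
rewrite Zi (reindex (@enum_rank J)) /=; last exact: (onW_bij _ (enum_rank_bij _)).
rewrite [RHS]big_mkcond; apply: eq_bigr => i _; rewrite /B enum_rankK.
by case: ifP => //; rewrite preimage_setT probability_setT.
Qed.

End IndependentPoisson.

(** * Limits *)

Section Asymptotics.
Local Open Scope ring_scope.
Local Open Scope classical_set_scope.
Variable R : realType.

Lemma cvg_invn : (fun N => N%:R^-1 : R) @ \oo --> (0 : R).
Proof.
apply/gtr0_cvgV0; last exact: cvgr_idn.
by near=> N; rewrite ltr0n; near: N; exact: nbhs_infty_gt.
Unshelve. all: by end_near. Qed.

Lemma pairing_count_gt0 k : (0 < pairing_count k.*2)%N.
Proof. by elim: k => // k IH; rewrite doubleS /= muln_gt0. Qed.

Lemma card_Omega_neq0 N : (#|Omega N|%:R : R) != 0.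
Proof.
rewrite card_Omega pnatr_eq0 -lt0n (_ : (6 * N)%N = (3 * N).*2) ?pairing_count_gt0 //.
by rewrite -mul2n mulnA.
Qed.

(** One more prescribed pair divides the number of pairings by [6N - 2l - 1], which is asymptotic to
    [6N]. *)
Lemma cvg_pairing_ratio l :
  (fun N => N%:R ^+ l * (pairing_count (6 * N - l.*2))%:R / #|Omega N|%:R : R) @ \oo -->
  (6^-1 ^+ l : R).
Proof.
elim: l => [|l IH].
  rewrite expr0 (_ : (fun N => _) = cst 1); first exact: cvg_cst.
  by apply/funext => N; rewrite expr0 mul1r subn0 -card_Omega divff // card_Omega_neq0.
have c1 : (fun N => (6 - l.*2.+1%:R * N%:R^-1)^-1 : R) @ \oo --> (6^-1 : R).
  rewrite -[X in X^-1]subr0 -(mulr0 (l.*2.+1%:R : R)); apply: cvgV.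
    by rewrite mulr0 subr0 pnatr_eq0.
  by apply: cvgB; [exact: cvg_cst | apply: cvgMl_tmp; exact: cvg_invn].
rewrite exprS mulrC; apply: cvg_trans (cvgM IH c1); apply: near_eq_cvg; near=> N.
have N0 : (N%:R : R) != 0 by rewrite pnatr_eq0 -lt0n; near: N; exact: nbhs_infty_gt.
have lN : (l <= N)%N by near: N; exact: nbhs_infty_ge.
have N1 : (0 < N)%N by rewrite lt0n -(@pnatr_eq0 R).
rewrite /= (_ : (6 * N - l.*2)%N = (6 * N - l.+1.*2).+2); last by lia.
rewrite [pairing_count _.+2]/= natrM.
have -> : ((6 * N - l.+1.*2).+1%:R : R) = 6 * N%:R - l.*2.+1%:R.
  rewrite -natrM -natrB; last by lia.
  by congr (_%:R); lia.
have d0 : 6 * N%:R - l.*2.+1%:R != 0 :> R.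
  by rewrite -natrM -natrB ?pnatr_eq0; lia.
have -> : 6 - l.*2.+1%:R / N%:R = (6 * N%:R - l.*2.+1%:R) / N%:R :> R by field.
rewrite exprS; have := card_Omega_neq0 N; move: (#|_|%:R : R) (pairing_count _)%:R => c p c0.
by move: (_ - _) d0 => d d0; field; rewrite c0 d0 N0.
Unshelve. all: by end_near. Qed.

Lemma cvg_ffact_ratio l : (fun N => ((2 * N) ^_ l)%:R / N%:R ^+ l : R) @ \oo --> (2 ^+ l : R).
Proof.
elim: l => [|l IH].
  rewrite expr0 (_ : (fun N => _) = cst 1); first exact: cvg_cst.
  by apply/funext => N; rewrite expr0 ffactn0 divr1.
have c1 : (fun N => 2 - l%:R * N%:R^-1 : R) @ \oo --> (2 : R).
  rewrite -[X in _ --> X]subr0 -(mulr0 (l%:R : R)).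
  by apply: cvgB; [exact: cvg_cst | apply: cvgMl_tmp; exact: cvg_invn].
rewrite exprS mulrC; apply: cvg_trans (cvgM IH c1); apply: near_eq_cvg; near=> N.
have N0 : (N%:R : R) != 0 by rewrite pnatr_eq0 -lt0n; near: N; exact: nbhs_infty_gt.
have lN : (l <= 2 * N)%N.
  by apply: (@leq_trans N); [near: N; exact: nbhs_infty_ge | rewrite leq_pmull].
rewrite /= ffactnSr natrM natrB // natrM exprS.
by move: (N%:R ^+ l) (expf_neq0 l N0) => p p0; field; rewrite p0 N0.
Unshelve. all: by end_near. Qed.

Lemma cvg_mean_family_count cs :
  (fun N => (\sum_(w in Omega N) family_count cs w)%:R / #|Omega N|%:R : R) @ \oo -->
  ((\prod_(c <- cs) class_card c)%N%:R : R).
Proof.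
set l := total_length cs; set C := (\prod_(c <- cs) class_card c)%N.
(* Per vertex there are 3 entry slots and about [2N] positions, against a probability of about
   [1/(6N)] for its edge; the constants cancel. *)
have -> : C%:R = C%:R * 3 ^+ l * (2 ^+ l * 6^-1 ^+ l) :> R.
  by rewrite -exprMn -mulrA -exprMn (_ : 3 * (2 * 6^-1) = 1) ?expr1n ?mulr1 //; field.
apply: cvg_trans (cvgMl_tmp (cvgM (@cvg_ffact_ratio l) (@cvg_pairing_ratio l))).
apply: near_eq_cvg; near=> N.
have N0 : (N%:R : R) != 0 by rewrite pnatr_eq0 -lt0n; near: N; exact: nbhs_infty_gt.
rewrite sum_family_count -/l -/C !natrM natrX /=; have := card_Omega_neq0 N.
move: (N%:R ^+ l) (expf_neq0 l N0) (#|_|%:R) => p p0 c c0.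
move: (C%:R) (3 ^+ l) (_ ^_ _)%:R (pairing_count _)%:R => x y z t.
by field; rewrite p0 c0.
Unshelve. all: by end_near. Qed.

(** Prescribing [n.+2] edges costs that many factors [N], while the vertices supply only [n.+1]; a
    factor [1/N] remains in each of finitely many terms. *)
Lemma cvg_bad_bound M cs :
  (fun N => (bad_bound N M cs)%:R / #|Omega N|%:R : R) @ \oo --> (0 : R).
Proof.
pose C n : R := 2 ^+ n.+1 * (((n.+1 * 3) ^ 2) ^ n.+2 * ((n.+2).*2 ^ 2) ^ total_length cs)%N%:R.
have c0 : (fun N => \sum_(n < 2 * M + total_length cs) C n *
    (N%:R ^+ n.+2 * (pairing_count (6 * N - n.+2.*2))%:R / #|Omega N|%:R * N%:R^-1) : R)
    @ \oo --> (0 : R).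
  rewrite -[X in _ --> X](_ : \sum_(n < 2 * M + total_length cs) C n * (6^-1 ^+ n.+2 * 0) = 0).
    by apply: cvg_sumr => n _; apply: cvgMl_tmp; apply: cvgM (@cvg_pairing_ratio _) cvg_invn.
  by rewrite big1 // => n _; rewrite !mulr0.
apply: cvg_trans c0; apply: near_eq_cvg; near=> N.
have N0 : (N%:R : R) != 0 by rewrite pnatr_eq0 -lt0n; near: N; exact: nbhs_infty_gt.
rewrite /bad_bound natr_sum big_distrl /=; apply: eq_bigr => n _.
rewrite natrM -mulnA natrM natrX [(2 * N)%:R]natrM exprMn /C; have := card_Omega_neq0 N.
move: (_ * _)%N%:R (pairing_count _)%:R (#|_|%:R) => A p c c0.
by rewrite [N%:R ^+ n.+2]exprS; move: (N%:R ^+ _) (2 ^+ _) => x y; field; rewrite c0 N0.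
Unshelve. all: by end_near. Qed.

Lemma cvg_good_family_count M cs :
  (fun N => (\sum_(w in Omega N | good M w) family_count cs w)%:R / #|Omega N|%:R : R) @ \oo -->
  ((\prod_(c <- cs) class_card c)%N%:R : R).
Proof.
have c0 : (fun N => (\sum_(w in Omega N | ~~ good M w) family_count cs w)%:R / #|Omega N|%:R : R)
    @ \oo --> (0 : R).
  apply: (squeeze_cvgr _ (cvg_cst 0) (@cvg_bad_bound M cs)); near=> N.
  by rewrite divr_ge0 ?ler0n //= ler_wpM2r ?invr_ge0 ?ler0n // ler_nat sum_family_count_bad.
rewrite -[X in _ --> X]subr0; apply: cvg_trans (cvgB (@cvg_mean_family_count cs) c0).
apply: near_eq_cvg; near=> N.
rewrite [LHS](_ : _ = (\sum_(w in Omega N) family_count cs w)%:R / #|Omega N|%:R -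
  (\sum_(w in Omega N | ~~ good M w) family_count cs w)%:R / #|Omega N|%:R) //.
by rewrite (bigID (@good N M)) /= natrD mulrDl addrK.
Unshelve. all: by end_near. Qed.

End Asymptotics.

Lemma class_card_gt0 c : 0 < class_card c.
Proof.
have sz : size (val (repr c)) == class_length c by [].
by apply/card_gt0P; exists (Tuple sz); exact: dihedral_refl.
Qed.

Lemma lambda_gt0 (R : realType) c : (0 < lambda R c)%R.
Proof.
by rewrite /lambda divr_gt0 // ltr0n ?class_card_gt0 // muln_gt0 class_length_gt0.
Qed.

(** * Convergence of the joint probabilities *)

Section Convergence.
Local Open Scope ring_scope.
Local Open Scope classical_set_scope.
Variable (R : realType) (I : finType) (f : I -> word_class).
Hypothesis f_inj : injective f.

Let M := \max_i class_length (f i).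

Let weight N (w : {set {set half_edge N}}) : R :=
  ((w \in Omega N) && good M w)%:R / #|Omega N|%:R.

Lemma cvg_good_moments (k : I -> nat) :
  (fun N => \sum_(w : {set {set half_edge N}}) weight w * \prod_i (Z_count (f i) w ^_ k i)%:R)
    @ \oo --> \prod_i lambda R (f i) ^+ k i.
Proof.
(* Each class is repeated as often as the order of its factorial moment. Dividing by [D], the number
   of versions of the circuits in a family, turns cardinalities of classes into the rates
   [lambda]. *)
pose r := flatten [seq nseq (k i) i | i <- enum I].
have rk i : count_mem i r = k i.
  rewrite /r count_flatten -map_comp sumnE big_map big_enum (bigD1 i) //=.
  by rewrite count_nseq /= eqxx mul1n big1 ?addn0 // => j /negPf ji; rewrite count_nseq /= ji.
have prod_r (F : word_class -> nat) : (\prod_(c <- map f r) F c = \prod_i F (f i) ^ k i)%N.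
  rewrite big_map big_flatten big_map big_enum; apply: eq_bigr => i _.
  by rewrite big_nseq iter_muln_1.
pose D : R := \prod_i (2 * class_length (f i))%N%:R ^+ k i.
have D0 : D != 0.
  rewrite prodf_seq_neq0; apply/allP => i _ /=; rewrite expf_neq0 // pnatr_eq0 -lt0n.
  by rewrite muln_gt0 class_length_gt0.
have -> : \prod_i lambda R (f i) ^+ k i = (\prod_(c <- map f r) class_card c)%N%:R * D^-1.
  rewrite prod_r natr_prod /D -prodfV -big_split; apply: eq_bigr => i _ /=.
  by rewrite natrX /lambda expr_div_n.
apply: cvg_trans (cvgMr_tmp (@cvg_good_family_count R M (map f r))).
apply: near_eq_cvg; near=> N; rewrite /= natr_sum big_mkcond big_distrl big_distrl /=.
apply: eq_bigr => w _; rewrite /weight; case: andP => [[wO gw]|_]; last by rewrite !mul0r.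
rewrite (family_countE r f_inj gw) => [|i]; last exact: (leq_bigmax i).
rewrite natr_prod; under eq_bigr do rewrite rk natrM natrX.
rewrite big_split -/D /= mul1r; move: (card_Omega_neq0 R N) => c0.
by move: (\prod_i _%:R) => X; field; rewrite D0 c0.
Unshelve. all: by end_near. Qed.

(** The probability lies between the weight of the event on good pairings and this weight plus the
    probability of a bad pairing. *)
Lemma cvg_Z_count (n : I -> nat) :
  (fun N => counting_prob R (Omega N) (fun w => [forall i, Z_count (f i) w == n i]))
    @ \oo --> \prod_i poisson_pmf (lambda R (f i)) (n i).
Proof.
have w0 N (w : {set {set half_edge N}}) : 0 <= weight w by rewrite divr_ge0 ?ler0n.
have good_cvg := @cvg_pmf_of_moments _ _ _ _ _ _ w0 cvg_good_moments n.
have bad_cvg : (fun N => (\sum_(w in Omega N | ~~ good M w) 1)%:R / #|Omega N|%:R : R)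
    @ \oo --> (0 : R).
  (* For the empty list of classes every pairing has exactly one family, so the bound counts the bad
     pairings themselves. *)
  apply: (squeeze_cvgr _ (cvg_cst 0) (@cvg_bad_bound R M [::])); near=> N.
  rewrite divr_ge0 ?ler0n //= ler_wpM2r ?invr_ge0 ?ler0n // ler_nat.
  apply: leq_trans (sum_family_count_bad N M [::]); apply: leq_sum => w _.
  by rewrite /family_count /= big_seq1.
have -> : \prod_i poisson_pmf (lambda R (f i)) (n i) = \prod_i
    (lambda R (f i) ^+ n i * (n i)`!%:R^-1 * expR (- lambda R (f i))) + 0.
  by rewrite addr0; apply: eq_bigr => i _; rewrite /poisson_pmf lambda_gt0.
pose E N (w : {set {set half_edge N}}) := [forall i, Z_count (f i) w == n i].
have lower : (fun N => \sum_(w : {set {set half_edge N}}) weight w * (E N w)%:R) @ \oo -->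
    \prod_i (lambda R (f i) ^+ n i * (n i)`!%:R^-1 * expR (- lambda R (f i))) + 0.
  by rewrite addr0.
apply: (squeeze_cvgr _ lower (cvgD good_cvg bad_cvg)); near=> N.
have -> : counting_prob R (Omega N) (@E N) =
    \sum_(w : {set {set half_edge N}}) (w \in Omega N)%:R / #|Omega N|%:R * (E N w)%:R.
  rewrite /counting_prob -[X in X%:R / _]sum1_card natr_sum big_mkcond big_distrl /=.
  by apply: eq_bigr => w _; rewrite inE; case: (w \in _); case: (E N w);
    rewrite ?mul0r ?mulr0 ?mulr1.
have c0 : 0 <= #|Omega N|%:R^-1 :> R by rewrite invr_ge0 ler0n.
apply/andP; split.
  apply: ler_sum => w _; rewrite ler_wpM2r ?ler0n // ler_wpM2r // ler_nat.
  by case: (w \in _) (good _ _) => -[].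
rewrite [leRHS](_ : _ = \sum_(w : {set {set half_edge N}}) weight w * (E N w)%:R +
  (\sum_(w in Omega N | ~~ good M w) 1)%:R / #|Omega N|%:R) //.
have -> : (\sum_(w in Omega N | ~~ good M w) 1)%:R / #|Omega N|%:R =
    \sum_(w : {set {set half_edge N}}) ((w \in Omega N) && ~~ good M w)%:R / #|Omega N|%:R :> R.
  rewrite natr_sum big_mkcond big_distrl; apply: eq_bigr => w _ /=.
  by case: ifP.
rewrite -big_split; apply: ler_sum => w _ /=.
rewrite /weight -/(E N w); case: (w \in _) (good _ _) (E N w) => -[] []; rewrite /=
  ?mul0r ?mulr0 ?mulr1 ?mul1r ?add0r ?addr0 //.
Unshelve. all: by end_near. Qed.

End Convergence.

Theorem theoremB (R : realType) (W : {fset word_class}) :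
  exists (d : measure_display) (T : measurableType d) (P : probability T R)
         (Z : W -> {RV P >-> nat}),
    [/\ cvg_in_distribution (fun (N : nat) (i : W) => @Z_count N (val i)) Z,
        forall i : W, poisson_distributed (Z i) (lambda R (val i))
      & independent Z].
Proof.
have [d [T [P [Z [Zp Zi]]]]] := independent_poisson (fun i : W => lambda_gt0 R (val i)).
exists d, T, P, Z; split=> // n.
(* Independence over the full index set identifies the limiting joint probability with the product
   of Poisson masses. *)
have -> : fine (P (\bigcap_i (Z i @^-1` [set n i]))%classic) =
    (\prod_i poisson_pmf (lambda R (val i)) (n i))%R.
  have := Zi [set: W]%SET (fun i => [set n i]%classic).
  rewrite (_ : [set` _]%classic = setT); last by apply/seteqP; split=> i //= _; rewrite inE.
  move=> ->; rewrite (eq_bigr (fun i => (poisson_pmf (lambda R (val i)) (n i))%:E)) => [|i _].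
    by rewrite prodEFin /=; apply: eq_bigl => i; rewrite inE.
  exact: Zp.
exact: (@cvg_Z_count R W (fun i : W => val i) val_inj n).
Qed.
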